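(* There is a universal constant $C_{\mathrm{JL}}<\infty$ such that the following holds. Let $n\ge2$, let $x\in SO(n)$, and let $M\sim \mathcal{K}_{n,T,x}$ be the endpoint of $T$ steps of Kac's walk on $SO(n)$ started from $x$. Let $\mathcal{X}=\{x_1,\dots,x_N\}\subset\mathbb{R}^n$ have $N\ge2$ points, and let $0<\varepsilon,\delta<1/2$. Set $r=\lceil\log(N/\delta)\rceil$ and assume $4r<n$. Let $\ell$ be an integer satisfying $C_{\mathrm{JL}}\varepsilon^{-2}r\le \ell<n$. If $$T\ge C_{\mathrm{JL}}\,n(4r+\log n)\left(r\log\frac n\varepsilon+\log\frac N\delta\right),$$ then with probability at least $1-\delta$ over $M$, $$(1-\varepsilon)\|x_i-x_j\|_2^2\le\|A_M(x_i-x_j)\|_2^2\le(1+\varepsilon)\|x_i-x_j\|_2^2\quad\text{for every pair }1\le i<j\le N.$$ In particular, for fixed $\varepsilon$ and $N/\delta\le n^A$ with $A<\infty$ fixed, the target dimension $\ell=O(\varepsilon^{-2}\log(N/\delta))=O_A(\varepsilon^{-2}\log n)$ is achieved (i.e. for such an $\ell$, under the standing requirements $4r<n$ and $\ell<n$, with probability at least $1-\delta$ over $M$ one has $(1-\varepsilon)\|x_i-x_j\|_2^2\le\|A_M(x_i-x_j)\|_2^2\le(1+\varepsilon)\|x_i-x_j\|_2^2$ for every pair $1\le i<j\le N$) by taking $T\ge C_A\,n\log^3 n$, where $C_A$ is a constant depending only on $A$ and the fixed $\varepsilon$.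
   Context: For $G\in SO(n)$, $A_G=\sqrt{n/\ell}\,\Pi_\ell G$, where $\Pi_\ell:\mathbb{R}^n\to\mathbb{R}^\ell$ is the coordinate projection onto the first $\ell$ coordinates. For $1\le i<j\le n$ and $\theta\in[0,2\pi)$ let $R_{ij}(\theta)=I_n+(\cos\theta-1)(E_{ii}+E_{jj})+\sin\theta\,E_{ij}-\sin\theta\,E_{ji}$, where $E_{ab}$ are the matrix units. Kac's walk on $SO(n)$ is $X_{t+1}=R_{i_tj_t}(\theta_t)X_t$, with $(i_t,j_t)$ i.i.d. uniform on $\{(i,j):1\le i<j\le n\}$ and $\theta_t$ i.i.d. uniform on $[0,2\pi)$, independent of the pairs. $\mathcal{K}_{n,T,x}$ is the law of $X_T$ when $X_0=x$. *)

(* Defs.v *)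
From HB Require Import structures.
From mathcomp Require Import all_boot all_order all_algebra.
From mathcomp Require Import finmap.
From mathcomp Require Import all_classical all_reals all_analysis.

Set Implicit Arguments.
Unset Strict Implicit.
Unset Printing Implicit Defensive.

Import Order.TTheory GRing.Theory Num.Theory.
Import numFieldNormedType.Exports.

Local Open Scope classical_set_scope.
Local Open Scope ring_scope.

Definition special_orthogonal (R : realType) (n : nat) (G : 'M[R]_n) : Prop :=
  G *m G^T = 1%:M /\ \det G = 1.

Definition l2norm (R : realType) (m : nat) (v : 'cV[R]_m) : R :=
  Num.sqrt (\sum_(i < m) v i ord0 ^+ 2).

(* [pid_mx l : 'M_(l, n)] has entries [i == j], so it is the projection onto
   the first l coordinates when l <= n. *)
Definition jl_matrix (R : realType) (n l : nat) (G : 'M[R]_n) : 'M[R]_(l, n) :=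
  Num.sqrt (n%:R / l%:R) *: ((pid_mx l : 'M[R]_(l, n)) *m G).

Definition jl_preserves (R : realType) (n l N : nat) (eps : R)
    (X : 'I_N -> 'cV[R]_n) (G : 'M[R]_n) : Prop :=
  forall i j : 'I_N, (i < j)%N ->
    (1 - eps) * l2norm (X i - X j) ^+ 2
      <= l2norm (jl_matrix l G *m (X i - X j)) ^+ 2
      <= (1 + eps) * l2norm (X i - X j) ^+ 2.

Definition jl_r (R : realType) (N : nat) (delta : R) : int :=
  Num.ceil (ln (N%:R / delta)).

Definition rotation_mx (R : realType) (n : nat) (i j : 'I_n) (theta : R) :
    'M[R]_n :=
  1%:M + (cos theta - 1) *: (delta_mx i i + delta_mx j j)
    + sin theta *: delta_mx i j - sin theta *: delta_mx j i.

Notation coord_pair n := {p : 'I_n * 'I_n | (p.1 < p.2)%N}.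

Lemma two_pi_gt0 (R : realType) : 0 < 2 * pi :> R.
Proof. by rewrite mulr_gt0// pi_gt0. Qed.

(* Mutual independence of a family of systems of events: the product rule over
   every finite subfamily. *)
Definition mutually_independent (R : realType) (d : measure_display)
    (Omega : measurableType d) (P : probability Omega R)
    (I : choiceType) (F : I -> set_system Omega) : Prop :=
  forall (J : {fset I}) (E : I -> set Omega),
    (forall i, i \in J -> F i (E i)) ->
    P (\bigcap_(i in [set` J]) E i) = (\prod_(i <- J) P (E i))%E.

(* The events generated by the t-th pair ([inl t]) and by the t-th angle
   ([inr t]); pairs carry the discrete sigma-algebra. *)
Definition kac_events (R : realType) (d : measure_display)
    (Omega : measurableType d) (n : nat)
    (ij : nat -> Omega -> coord_pair n) (theta : nat -> Omega -> R)
    (k : nat + nat) : set_system Omega :=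
  match k with
  | inl t => [set ij t @^-1` S | S in [set: set (coord_pair n)]]
  | inr t => [set theta t @^-1` B | B in measurable]
  end.

(* The library's uniform law on `[0, 2 * pi] coincides with that on
   `[0, 2 * pi[ since endpoints are negligible. *)
Record kac_driving (R : realType) (d : measure_display)
    (Omega : measurableType d) (P : probability Omega R) (n : nat)
    (ij : nat -> Omega -> coord_pair n) (theta : nat -> {RV P >-> R}) : Prop :=
  KacDriving {
    kac_pair_measurable : forall t p, measurable (ij t @^-1` [set p]);
    kac_pair_uniform : forall t p,
      P (ij t @^-1` [set p]) = (#|{: coord_pair n}|%:R^-1)%:E;
    kac_angle_uniform : forall t (B : set R), measurable B ->
      distribution P (theta t) B = uniform_prob (two_pi_gt0 R) B;
    kac_independent :
      mutually_independent P (kac_events ij (fun t => theta t : Omega -> R))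
  }.

Fixpoint kac_walk (R : realType) (Omega : Type) (n : nat)
    (ij : nat -> Omega -> coord_pair n) (theta : nat -> Omega -> R)
    (x : 'M[R]_n) (t : nat) (w : Omega) {struct t} : 'M[R]_n :=
  if t is s.+1 then
    rotation_mx (val (ij s w)).1 (val (ij s w)).2 (theta s w)
      *m kac_walk ij theta x s w
  else x.

(* "M ~ K_(n,T,x) satisfies E with probability at least c": the quantification
   over all realizations of the driving sequence is harmless since the law of
   the endpoint does not depend on the realization. *)
Definition kac_prob_ge (R : realType) (n T : nat) (x : 'M[R]_n)
    (E : 'M[R]_n -> Prop) (c : R) : Prop :=
  forall (d : measure_display) (Omega : measurableType d)
    (P : probability Omega R) (ij : nat -> Omega -> coord_pair n)
    (theta : nat -> {RV P >-> R}),
    kac_driving ij theta ->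
    (c%:E <= P [set w | E (kac_walk ij (fun t => theta t : Omega -> R) x T w)])%E.

(* Main.v *)
(** For a unit vector u the squared coordinates y of X_t u form a Markov chain:
    a step replaces y_i and y_j by (y_i + y_j) cos^2 phi and
    (y_i + y_j) sin^2 phi, and phi is again uniform because the angle of
    (u_i, u_j) only shifts theta. Hence E f(<t, y_{T+1}>) is the mean of
    E f(<t', y_T>) over the dual step t'_i = t'_j = t_i cos^2 phi + t_j sin^2 phi,
    and after T steps the weights t = 1_{k < l} are nearly constant.

    In the dual step with D = t_i - t_j, the total weight moves by D cos(2 phi)
    while the sum of squares drops on average by D^2 / 4, so
    exp (a sum t + b sum t^2) is a supermartingale as soon as b is a large
    multiple of a^2. With a of order +-eps this keeps the mean weight within
    l/n (1 +- eps/2) up to probability 2 exp (- c eps^2 l). The variance of the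
    weights contracts by 1 - 1/(2n) per step, which makes |<t, y_0> - mean t|
    negligible. A union bound over the pairs x_i - x_j concludes; only
    n (log n + log (N/delta)) steps are needed. *)
Require Import Defs.
From HB Require Import structures.
From mathcomp Require Import all_boot all_order all_algebra.
From mathcomp Require Import finmap.
From mathcomp Require Import all_classical all_reals all_analysis.
From mathcomp Require Import measurable_realfun.
From mathcomp Require Import ring lra.

Set Implicit Arguments.
Unset Strict Implicit.
Unset Printing Implicit Defensive.

Import Order.TTheory GRing.Theory Num.Theory.
Import numFieldNormedType.Exports.

Local Open Scope ring_scope.

(** * Integrating against an independent angle *)

Section independence.
Local Open Scope classical_set_scope.
Local Open Scope ereal_scope.

Lemma ge0_integral_mrestr d (T : measurableType d) (R : realType)
    (mu : {measure set T -> \bar R}) (D : set T) (mD : measurable D)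
    (f : T -> \bar R) :
  measurable_fun setT f -> (forall x, 0 <= f x) ->
  \int[mrestr mu mD]_x f x = \int[mu]_(x in D) f x.
Proof.
move=> mf f0.
have mrD0 : mrestr mu mD (~` D) = 0 by rewrite /= /mrestr setICl measure0.
rewrite (ge0_negligible_integral (measurableC mD) measurableT mf _ mrD0)//.
rewrite setTD setCK.
by apply: eq_measure_integral => A mA AD; rewrite /= /mrestr setIidl.
Qed.

(** For fixed [D] and [B] both sides are measures in [A]; the left one is finite, and they agree on
    the pi-system [G] that generates the sigma-algebra and contains the full space, so uniqueness of
    measures applies. *)
Lemma indep_joint_law d d' (Omega : measurableType d) (T : measurableType d')
    (R : realType) (P : probability Omega R) (Z : Omega -> T) (G : set_system T)
    (D : set Omega) (theta : {RV P >-> R})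
    (Q : probability (measurableTypeR R) R) (c : R) :
  measurable_fun setT Z -> @measurable _ T = <<s G >> -> setI_closed G ->
  G setT -> measurable D -> (0 < c)%R ->
  (forall A B, G A -> measurable B ->
     P (Z @^-1` A `&` (D `&` theta @^-1` B)) = c%:E * (P (Z @^-1` A) * Q B)) ->
  forall A B, measurable A -> measurable B ->
     P (Z @^-1` A `&` (D `&` theta @^-1` B)) = c%:E * (P (Z @^-1` A) * Q B).
Proof.
move=> mZ mG GI GT mD c0 PG A B mA mB.
have mtB : measurable (theta @^-1` B).
  by rewrite -[X in measurable X]setTI; exact: measurable_funPT.
have mDB : measurable (D `&` theta @^-1` B) by exact: measurableI.
have QB : Q B \is a fin_num by exact: fin_num_measure.
have cQ0 : (0 <= c * fine (Q B))%R by rewrite mulr_ge0 ?fine_ge0// ltW.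
pose push1 : {measure set T -> \bar R} := pushforward (mrestr P mDB) Z.
pose push2 : {measure set T -> \bar R} := pushforward P Z.
pose n1 := push1 mZ.
pose n2 : {measure set T -> \bar R} := mscale (NngNum cQ0) (push2 mZ).
have -> : P (Z @^-1` A `&` (D `&` theta @^-1` B)) = n1 A by [].
have n2E X : n2 X = c%:E * (P (Z @^-1` X) * Q B).
  by rewrite /n2 /= /mscale /= EFinM fineK// -muleA (muleC (Q B)).
rewrite -n2E.
apply: (measure_unique G (fun=> setT)) => //.
- by rewrite bigcup_const//; exists 0%N.
- by move=> X GX; rewrite n2E -PG.
- move=> _; rewrite /n1 /= /pushforward /mrestr /=.
  by rewrite (le_lt_trans (probability_le1 P _)) ?ltry// preimage_setT setTI.
Qed.

(** On [D] the joint law of [Z] and [theta] is [c] times a product law. Tonelli integrates the angle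
    first, for a frozen [z], where [H1] may be exchanged for [H2]. This absorbs an angular shift
    that depends on the state. *)
Lemma ge0_integral_indep d d' (Omega : measurableType d) (T : measurableType d')
    (R : realType) (P : probability Omega R) (Z : Omega -> T) (G : set_system T)
    (D : set Omega) (theta : {RV P >-> R})
    (Q : probability (measurableTypeR R) R) (c : R)
    (H1 H2 : T * measurableTypeR R -> \bar R) :
  measurable_fun setT Z -> @measurable _ T = <<s G >> -> setI_closed G ->
  G setT -> measurable D -> (0 < c)%R ->
  (forall A B, G A -> measurable B ->
     P (Z @^-1` A `&` (D `&` theta @^-1` B)) = c%:E * (P (Z @^-1` A) * Q B)) ->
  measurable_fun setT H1 -> (forall z, 0 <= H1 z) ->
  measurable_fun setT H2 -> (forall z, 0 <= H2 z) ->
  (forall z, \int[Q]_s H1 (z, s) = \int[Q]_s H2 (z, s)) ->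
  \int[P]_(w in D) H1 (Z w, theta w) = c%:E * \int[Q]_s \int[P]_w H2 (Z w, s).
Proof.
move=> mZ mG GI GT mD c0 PG mH1 H10 mH2 H20 H12.
pose Z' : {mfun Omega >-> T} := HB.pack Z (isMeasurableFun.Build _ _ _ _ Z mZ).
pose h (w : Omega) : T * measurableTypeR R := (Z w, theta w).
have mtheta : @measurable_fun _ _ Omega (measurableTypeR R) setT theta.
  exact: (measurable_funPT theta).
have mh : measurable_fun setT h by exact: measurable_fun_pair mZ mtheta.
have ci0 : (0 <= c^-1)%R by rewrite invr_ge0 ltW.
pose m1 : probability T R := distribution P Z'.
pose push : {measure set (T * measurableTypeR R) -> \bar R} :=
  pushforward (mrestr P mD) h.
(* Dividing by [c] turns the joint law on [D] into a candidate for the product measure, which is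
   characterized by its values on rectangles. *)
pose nu : {measure set (T * measurableTypeR R) -> \bar R} :=
  mscale (NngNum ci0) (push mh).
have nuE X : measurable X -> (m1 \x Q) X = nu X.
  apply: product_measure_unique => A B mA mB.
  rewrite /nu /= /mscale /= /pushforward /mrestr.
  have -> : h @^-1` (A `*` B) `&` D = Z @^-1` A `&` (D `&` theta @^-1` B).
    by apply/seteqP; split => w /=; tauto.
  rewrite (indep_joint_law mZ mG GI GT mD c0 PG mA mB) muleA -EFinM mulVf ?mul1e//.
  by rewrite gt_eqF.
have -> : \int[P]_(w in D) H1 (Z w, theta w) = c%:E * \int[nu]_z H1 z.
  rewrite /nu ge0_integral_mscale//= muleA -EFinM divff ?gt_eqF// mul1e.
  rewrite ge0_integral_pushforward//= preimage_setT ge0_integral_mrestr//.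
  exact: measurableT_comp.
congr (_ * _).
rewrite (eq_measure_integral (m1 \x Q)); last by move=> X mX _; rewrite -nuE.
rewrite fubini_tonelli1//= /fubini_F.
under eq_integral do rewrite H12.
rewrite fubini_tonelli//.
apply: eq_integral => s _.
rewrite ge0_integral_distribution//.
exact: measurableT_comp.
Qed.

End independence.

(** * Integrals over a uniform angle *)

Section circle.
Local Open Scope classical_set_scope.
Context {R : realType}.
Local Notation mu := (@lebesgue_measure R).
Local Notation circle := (uniform_prob (two_pi_gt0 R)).

Lemma lebesgue_measureD (k : R) (A : set R) : measurable A ->
  pushforward mu (fun x : measurableTypeR R => x + k : measurableTypeR R) A
  = mu A.
Proof.
have mk : measurable_fun setT (fun x : measurableTypeR R => x + k : measurableTypeR R).
  exact: measurable_funD.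
pose push : {measure set (measurableTypeR R) -> \bar R} :=
  pushforward mu (fun x : measurableTypeR R => x + k : measurableTypeR R).
move=> mA; apply/esym/(lebesgue_measure_unique (mu := push mk)) => //= _ [[a b]] _ <-.
rewrite /pushforward.
have -> : (fun x : R => x + k) @^-1` `]a, b] = `]a - k, b - k]%classic.
  by apply/seteqP; split => x /=; rewrite !in_itv/= ltrBlDr lerBrDr.
by rewrite !lebesgue_measure_itv/= !lte_fin ltrD2r -!EFinB opprB addrA subrK.
Qed.

Lemma ge0_integralD_shift (f : R -> \bar R) (k a b : R) :
  measurable_fun setT f -> (forall x, 0 <= f x)%E ->
  (\int[mu]_(x in `[a, b[) f (x + k)%R
   = \int[mu]_(x in `[(a + k)%R, (b + k)%R[) f x)%E.
Proof.
move=> mf f0.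
have mk : measurable_fun setT (fun x : measurableTypeR R => x + k : measurableTypeR R).
  exact: measurable_funD.
pose push : {measure set (measurableTypeR R) -> \bar R} :=
  pushforward mu (fun x : measurableTypeR R => x + k : measurableTypeR R).
rewrite [RHS](@eq_measure_integral _ _ _ _ (push mk)); last first.
  by move=> A mA _; exact/esym/lebesgue_measureD.
rewrite ge0_integral_pushforward//=; last exact: measurable_funTS.
congr (integral _ _ _).
by apply/seteqP; split => x /=; rewrite !in_itv/= lerD2r ltrD2r.
Qed.

Lemma ge0_integral_itvco_setU (f : R -> \bar R) (a b c : R) :
  measurable_fun setT f -> (forall x, 0 <= f x)%E -> a <= b -> b <= c ->
  (\int[mu]_(x in `[a, c[) f x
   = \int[mu]_(x in `[a, b[) f x + \int[mu]_(x in `[b, c[) f x)%E.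
Proof.
move=> mf f0 ab bc.
rewrite -ge0_integral_setU//; first by rewrite -itv_bndbnd_setU// bnd_simp.
- exact: measurable_funTS.
- apply/disj_setPS => x [] /=; rewrite !in_itv/= => /andP[_ xb] /andP[bx _].
  by move: xb; rewrite ltNge bx.
Qed.

Lemma integral_circle (f : R -> \bar R) :
  measurable_fun setT f -> (forall x, 0 <= f x)%E ->
  (\int[circle]_x f x = (2 * pi)^-1%:E * \int[mu]_(x in `[0%R, (2 * pi)%R[) f x)%E.
Proof.
move=> mf f0; rewrite integral_uniform// subr0 integral_itv_bndo_bndc//.
exact: measurable_funTS.
Qed.

(** The shift moves the window to [k, 2 pi + k); the part beyond 2 pi is carried back to [0, k) by
    periodicity. *)
Lemma integral_circle_shift (f : R -> \bar R) (k : R) :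
  measurable_fun setT f -> (forall x, 0 <= f x)%E ->
  (forall x, f (x + 2 * pi)%R = f x) -> 0 <= k <= 2 * pi ->
  (\int[circle]_x f (x + k)%R = \int[circle]_x f x)%E.
Proof.
move=> mf f0 per /andP[k0 k2].
have mfk : measurable_fun setT (fun x : R => f (x + k)).
  by apply: measurableT_comp => //; exact: measurable_funD.
rewrite !integral_circle//; congr (_ * _)%E.
rewrite ge0_integralD_shift// add0r.
rewrite (@ge0_integral_itvco_setU f k (2 * pi))//; last by rewrite lerDl.
rewrite (@ge0_integral_itvco_setU f 0 k)// addeC; congr (_ + _)%E.
rewrite -{1}(add0r (2 * pi)) (addrC _ k) -ge0_integralD_shift//.
by apply: eq_integral => x _; rewrite per.
Qed.

(** The angle is plus or minus [acos] of the normalized first coordinate, with the sign of [b]. The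
    bound on [k] keeps the later shift within one period, as [integral_circle_shift] requires. *)
Lemma polar_coordinates (a b : R) : exists2 k : R, `|k| <= pi &
  a = Num.sqrt (a ^+ 2 + b ^+ 2) * cos k /\
  b = Num.sqrt (a ^+ 2 + b ^+ 2) * sin k.
Proof.
set s := a ^+ 2 + b ^+ 2; have s0 : 0 <= s by rewrite addr_ge0 ?sqr_ge0.
have [/eqP|sn0] := eqVneq s 0.
  rewrite paddr_eq0 ?sqr_ge0// !sqrf_eq0 => /andP[/eqP a0 /eqP b0].
  by exists 0; rewrite ?normr0 ?pi_ge0// /s a0 b0 expr0n/= addr0 sqrtr0 !mul0r.
have r0 : 0 < Num.sqrt s by rewrite sqrtr_gt0 lt_def sn0.
pose x := a / Num.sqrt s; pose y := b / Num.sqrt s.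
have xy : x ^+ 2 + y ^+ 2 = 1.
  by rewrite !expr_div_n sqr_sqrtr// -mulrDl divff.
have x1 : -1 <= x <= 1.
  by rewrite -ler_norml -(@expr_le1 _ 2)// real_normK ?num_real// -xy lerDl sqr_ge0.
have cx : cos (acos x) = x by rewrite acosK// in_itv.
have sx : sin (acos x) = `|y|.
  by rewrite sin_acos// -xy addrC addKr sqrtr_sqr.
have ka : `|acos x| <= pi by rewrite ger0_norm ?acos_ge0 ?acos_lepi.
have aE : a = Num.sqrt s * x by rewrite /x mulrC divfK// gt_eqF.
have bE : b = Num.sqrt s * y by rewrite /y mulrC divfK// gt_eqF.
have [y0|y0] := leP 0 y.
  by exists (acos x) => //; rewrite cx sx ger0_norm.
by exists (- acos x); rewrite ?normrN// cosN sinN cx sx ltr0_norm// opprK.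
Qed.

Lemma rotation_square_cos (rho k s t1 t2 : R) :
  t1 * (cos s * (rho * cos k) + sin s * (rho * sin k)) ^+ 2
  + t2 * (cos s * (rho * sin k) - sin s * (rho * cos k)) ^+ 2
  = rho ^+ 2 * ((t1 + t2) / 2 + (t1 - t2) / 2 * cos ((s - k) *+ 2)).
Proof.
have -> : cos s * (rho * cos k) + sin s * (rho * sin k) = rho * cos (s - k).
  by rewrite cosB; ring.
have -> : cos s * (rho * sin k) - sin s * (rho * cos k) = - (rho * sin (s - k)).
  by rewrite sinB; ring.
rewrite sqrrN !exprMn sin2cos2 cos_mulr2n -mulr_natr; by field.
Qed.

Lemma continuous_cos_double : continuous (fun s : R => cos (s *+ 2)).
Proof.
under eq_fun do rewrite mulr2n.
move=> s; apply: (@continuous_comp _ _ _ (fun s : R => s + s) cos).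
  exact: cvgD.
exact: continuous_cos.
Qed.

Lemma measurable_cos_double : measurable_fun setT (fun s : R => cos (s *+ 2)).
Proof.
apply: continuous_measurable_fun; exact: continuous_cos_double.
Qed.

(** In polar coordinates the rotated vector has angle k - s, so its direction k only shifts the
    uniform angle and disappears from the integral; only the length survives. *)
Lemma integral_circle_rotation (f : R -> \bar R) (q a b t1 t2 : R) :
  measurable_fun setT f -> (forall x, 0 <= f x)%E ->
  (\int[circle]_s f (q + (t1 * (cos s * a + sin s * b) ^+ 2
                         + t2 * (cos s * b - sin s * a) ^+ 2))%R
   = \int[circle]_s f (q + (a ^+ 2 + b ^+ 2)
        * ((t1 + t2) / 2 + (t1 - t2) / 2 * cos (s *+ 2)))%R)%E.
Proof.
move=> mf f0.
have [k kpi [aE bE]] := polar_coordinates a b.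
pose F s := f (q + (a ^+ 2 + b ^+ 2) * ((t1 + t2) / 2 + (t1 - t2) / 2 * cos (s *+ 2))).
have mF : measurable_fun setT F.
  apply: measurableT_comp => //; apply: measurable_funD => //.
  apply: measurable_funM => //; apply: measurable_funD => //.
  apply: measurable_funM => //; exact: measurable_cos_double.
have F0 s : (0 <= F s)%E by exact: f0.
have mFk c : measurable_fun setT (fun s : R => F (s - c)).
  by apply: measurableT_comp => //; exact: measurable_funB.
have per s : F (s + 2 * pi) = F s.
  rewrite /F mulrnDl (_ : 2 * pi *+ 2 = pi *+ 2 *+ 2); last by rewrite mulr_natl.
  by rewrite (periodicn (@cosD2pi R)).
transitivity (\int[circle]_s F (s - k)%R)%E.
  apply: eq_integral => s _; rewrite /F; congr (f (_ + _)).
  have rhoE : Num.sqrt (a ^+ 2 + b ^+ 2) ^+ 2 = a ^+ 2 + b ^+ 2.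
    by rewrite sqr_sqrtr// addr_ge0 ?sqr_ge0.
  move: (Num.sqrt _) rhoE aE bE => rho <- -> ->.
  by rewrite rotation_square_cos.
move: kpi; rewrite ler_norml => /andP[k1 k2].
(* The shift lemma takes nonnegative shifts only, hence the two cases: for k >= 0 the shift by -k is
   undone, for k < 0 it is applied directly. *)
have pi0 := pi_ge0 R.
have [k0|k0] := leP 0 k.
  rewrite -(@integral_circle_shift (fun s : R => F (s - k)) k)//.
  - by apply: eq_integral => s _; rewrite addrK.
  - by move=> s; have -> : s + 2 * pi - k = s - k + 2 * pi by ring.
  - by rewrite k0/=; lra.
rewrite -[RHS](@integral_circle_shift F (- k))//.
by rewrite oppr_ge0 ltW//=; lra.
Qed.

(** Over a full period cos (2 s) has mean 0 and its square has mean 1/2. *)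
Lemma integral_circle_trig (F : R -> \bar R) (a b c : R) :
  measurable_fun setT F -> (forall s, 0 <= F s)%E ->
  (forall s, F s <= (a + b * cos (s *+ 2) + c * cos (s *+ 2) ^+ 2)%:E)%E ->
  (\int[circle]_s F s <= (a + c / 2)%:E)%E.
Proof.
move=> mF F0 Fle.
pose g (s : R) : R := a + b * cos (s *+ 2) + c * cos (s *+ 2) ^+ 2.
(* A primitive of [g]: the last two brackets are sin (2 s) / 2 and sin (4 s) / 4, and cos^2 (2 s) =
   (1 + cos (4 s)) / 2. *)
pose G (s : R) : R := (a + c / 2) * s + b * (sin s * cos s)
  + c / 2 * (sin s * cos s * (2 * (cos s * cos s) - 1)).
have dG (s : R) : is_derive s (1 : R) G (g s).
  rewrite /G; apply: is_derive_eq.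
  rewrite /GRing.scale/=.
  have sc : sin s * sin s = 1 - cos s * cos s by rewrite -!expr2 sin2cos2.
  rewrite /g cos_mulr2n; set S := sin s in sc *; set C := cos s in sc *.
  transitivity (a + c / 2 + b * (C * C - S * S) + c / 2 *
      (- 4 * (C * C) * (S * S) + (2 * (C * C) - 1) * (C * C - S * S))).
    by field.
  by rewrite sc; field.
have g0 s : 0 <= g s by rewrite -lee_fin (le_trans (F0 s)).
have cg : continuous g.
  move=> s; rewrite /g; apply: cvgD; last first.
    apply: cvgM; first exact: cvg_cst.
    by apply: cvgM; exact: continuous_cos_double.
  apply: cvgD; first exact: cvg_cst.
  by apply: cvgM; [exact: cvg_cst|exact: continuous_cos_double].
have mg : measurable_fun setT g by exact: continuous_measurable_fun.
have cG : continuous G.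
  by move=> s; apply: differentiable_continuous; apply/derivable1_diffP; apply: ex_derive.
have pi0 := pi_gt0 R.
have Gg : (\int[mu]_(s in `[0%R, (2 * pi)%R]) (g s)%:E = (G (2 * pi) - G 0)%:E)%E.
  rewrite EFinB; apply: continuous_FTC2 => //.
  - by rewrite mulr_gt0.
  - exact: continuous_subspaceT.
  - split; first by move=> s _; apply: ex_derive.
      by apply: cvg_at_right_filter; exact: cG.
    by apply: cvg_at_left_filter; exact: cG.
  - by move=> s _; rewrite derive1E; exact: derive_val.
apply: (@le_trans _ _ (\int[circle]_s (g s)%:E)%E).
  apply: ge0_le_integral => //.
  exact/measurable_EFinP.
rewrite integral_uniform//; last exact/measurable_EFinP.
rewrite subr0 Gg -EFinM lee_fin /G mulr_natl sin2pi sin0 !mul0r !mulr0 !addr0 subr0.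
by rewrite mulrCA mulVf ?mulr1// gt_eqF// pmulrn_lgt0.
Qed.
End circle.

(** * Weighted energies and the dual step on weights *)

Section energy.
Context {R : realType} {n : nat}.
Implicit Types (t : 'I_n -> R) (v : 'cV[R]_n) (p : coord_pair n).

Definition energy t v : R := \sum_(k < n) t k * v k ord0 ^+ 2.

(* The weights t' with <t, y'> = <t', y>, where y' is obtained from y by
   replacing both of its entries in p by shares (1 +- c) / 2 of their sum. *)
Definition dual_weights p (c : R) t : 'I_n -> R := fun k =>
  if (k == (val p).1) || (k == (val p).2)
  then (t (val p).1 + t (val p).2) / 2 + (t (val p).1 - t (val p).2) / 2 * c
  else t k.

Lemma coord_pair_neq p : (val p).2 != (val p).1.
Proof. by rewrite -val_eqE/= gtn_eqF// (valP p). Qed.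

Lemma sum_coord_pair p (F : 'I_n -> R) :
  \sum_k F k = F (val p).1 + F (val p).2
    + \sum_(k | (k != (val p).1) && (k != (val p).2)) F k.
Proof.
by rewrite (bigD1 (val p).1)//= (bigD1 (val p).2)/= ?coord_pair_neq// addrA.
Qed.

Lemma rotation_mxE p (s : R) v k :
  (rotation_mx (val p).1 (val p).2 s *m v) k ord0 =
  if k == (val p).1 then cos s * v (val p).1 ord0 + sin s * v (val p).2 ord0
  else if k == (val p).2 then cos s * v (val p).2 ord0 - sin s * v (val p).1 ord0
  else v k ord0.
Proof.
have deltaE (i j : 'I_n) : (delta_mx i j *m v) k ord0 = (k == i)%:R * v j ord0.
  rewrite mxE (bigD1 j)//= big1 ?addr0 => [|l lj]; first by rewrite mxE eqxx andbT.
  by rewrite mxE (negbTE lj) andbF mul0r.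
rewrite /rotation_mx !mulmxDl mulNmx -!scalemxAl mulmxDl mul1mx.
have addE (A B : 'cV[R]_n) : (A + B) k ord0 = A k ord0 + B k ord0 by rewrite mxE.
have oppE (A : 'cV[R]_n) : (- A) k ord0 = - A k ord0 by rewrite mxE.
have sclE c (A : 'cV[R]_n) : (c *: A) k ord0 = c * A k ord0 by rewrite mxE.
rewrite !(addE, oppE, sclE, deltaE).
have [->|k1] := eqVneq k (val p).1.
  by rewrite eq_sym (negbTE (coord_pair_neq p)) mulr1n mulr0n; ring.
have [->|k2] := eqVneq k (val p).2; rewrite ?mulr1n !mulr0n; ring.
Qed.

Lemma energy_rotation p s t v :
  energy t (rotation_mx (val p).1 (val p).2 s *m v) =
  \sum_(k | (k != (val p).1) && (k != (val p).2)) t k * v k ord0 ^+ 2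
  + (t (val p).1 * (cos s * v (val p).1 ord0 + sin s * v (val p).2 ord0) ^+ 2
     + t (val p).2 * (cos s * v (val p).2 ord0 - sin s * v (val p).1 ord0) ^+ 2).
Proof.
rewrite /energy (sum_coord_pair p) addrC !rotation_mxE eqxx.
rewrite (negbTE (coord_pair_neq p)) eqxx; congr (_ + _).
by apply: eq_bigr => k /andP[/negbTE k1 /negbTE k2]; rewrite rotation_mxE k1 k2.
Qed.

Lemma energy_dual p c t v :
  energy (dual_weights p c t) v =
  \sum_(k | (k != (val p).1) && (k != (val p).2)) t k * v k ord0 ^+ 2
  + (v (val p).1 ord0 ^+ 2 + v (val p).2 ord0 ^+ 2)
    * ((t (val p).1 + t (val p).2) / 2 + (t (val p).1 - t (val p).2) / 2 * c).
Proof.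
rewrite /energy (sum_coord_pair p) addrC /dual_weights !eqxx orbT/=.
congr (_ + _); last by rewrite -mulrDr mulrC.
by apply: eq_bigr => k /andP[/negbTE -> /negbTE ->].
Qed.

(** The duality behind the proof: once the angle is averaged, rotating the vector and averaging the
    weights give the same law, since both alter only the contribution of the two entries in [p]. *)
Lemma integral_circle_energy (f : R -> \bar R) p t v :
  measurable_fun setT f -> (forall x, 0 <= f x)%E ->
  (\int[uniform_prob (two_pi_gt0 R)]_s
     f (energy t (rotation_mx (val p).1 (val p).2 s *m v)) =
   \int[uniform_prob (two_pi_gt0 R)]_s
     f (energy (dual_weights p (cos (s *+ 2)) t) v))%E.
Proof.
move=> mf f0.
under eq_integral do rewrite energy_rotation.
rewrite integral_circle_rotation//.
by under [RHS]eq_integral do rewrite energy_dual.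
Qed.

End energy.

(** * Measurability, independence from the past, and iteration of the dual step *)

Section walk.
Local Open Scope classical_set_scope.
Context {R : realType} {n : nat}.

Lemma measurable_rotation d (T : measurableType d) (p : coord_pair n)
    (a : T -> R) (v : T -> 'cV[R]_n) :
  measurable_fun setT a ->
  (forall k, measurable_fun setT (fun z => v z k ord0)) ->
  forall k, measurable_fun setT
    (fun z => (rotation_mx (val p).1 (val p).2 (a z) *m v z) k ord0).
Proof.
move=> ma mv k; under eq_fun => z do rewrite rotation_mxE.
have mcos : measurable_fun setT (fun z => cos (a z)).
  by apply: measurableT_comp => //; apply: continuous_measurable_fun; exact: continuous_cos.
have msin : measurable_fun setT (fun z => sin (a z)).
  by apply: measurableT_comp => //; apply: continuous_measurable_fun; exact: continuous_sin.
case: (k == (val p).1); first by apply: measurable_funD; apply: measurable_funM.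
case: (k == (val p).2); last exact: mv.
by apply: measurable_funB; apply: measurable_funM.
Qed.

Lemma measurable_energy d (T : measurableType d) (t : T -> 'I_n -> R)
    (v : T -> 'cV[R]_n) :
  (forall k, measurable_fun setT (fun z => t z k)) ->
  (forall k, measurable_fun setT (fun z => v z k ord0)) ->
  measurable_fun setT (fun z => energy (t z) (v z)).
Proof.
move=> mt mv; apply: measurable_sum => k.
by apply: measurable_funM => //; exact: measurable_funX.
Qed.

(** The map [Z] lets the statement serve both for [Omega] itself and for [Omega] with the coarser
    sigma-algebra of the past. Only drivers with index below [N] have to be measurable. *)
Lemma measurable_kac_walk d d' (Omega : measurableType d) (T : measurableType d')
    (ij : nat -> Omega -> coord_pair n) (theta : nat -> Omega -> R)
    (Z : T -> Omega) (x : 'M[R]_n) (u : 'cV[R]_n) (N : nat) :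
  (forall s p, (s < N)%N -> measurable ((ij s \o Z) @^-1` [set p])) ->
  (forall s, (s < N)%N -> measurable_fun setT (theta s \o Z)) ->
  forall k, measurable_fun setT
    (fun z => (kac_walk ij theta x N (Z z) *m u) k ord0).
Proof.
elim: N => [|N IH] mij mtheta k; first exact: (measurable_cst ((x *m u) k ord0)).
pose h (p : coord_pair n) (z : T) : R := (rotation_mx (val p).1 (val p).2 (theta N (Z z))
  *m (kac_walk ij theta x N (Z z) *m u)) k ord0.
have mh p : measurable_fun setT (h p).
  apply: measurable_rotation; first exact: (mtheta N).
  by apply: IH => s; [move=> q|] => sN; [apply: mij|apply: mtheta]; exact: ltnW.
(* The pair takes finitely many values, so the step is a finite sum over its possible values, each
   cut off by an indicator. *)
rewrite (_ : (fun z => _) = fun z => \sum_(p : coord_pair n)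
    \1_((ij N \o Z) @^-1` [set p]) z * h p z).
  by apply: measurable_sum => p; apply: measurable_funM => //; apply: measurable_indic; exact: mij.
apply/funext => z; rewrite /= (bigD1 (ij N (Z z)))//= big1 ?addr0.
  by rewrite indicE mem_set// mul1r /h mulmxA.
move=> p pij; rewrite indicE memNset ?mul0r//= => E.
by rewrite E eqxx in pij.
Qed.

Fixpoint past_indices (N : nat) : {fset nat + nat} :=
  if N is s.+1 then (inl s |` (inr s |` past_indices s))%fset else fset0.

Lemma in_past_indices (N : nat) (k : nat + nat) :
  (k \in past_indices N) = (match k with inl s => s | inr s => s end < N)%N.
Proof.
elim: N => [|N IH] /=; first by rewrite inE.
rewrite !inE IH ltnS [in RHS]leq_eqVlt; case: k {IH} => s.
  by rewrite (inj_eq (@inl_inj nat nat)).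
by rewrite (inj_eq (@inr_inj nat nat)).
Qed.

Variables (d : measure_display) (Omega : measurableType d)
  (P : probability Omega R) (ij : nat -> Omega -> coord_pair n)
  (theta : nat -> {RV P >-> R}).
Hypothesis drive : kac_driving ij theta.
Let th t : Omega -> R := theta t.
Local Notation npairs := (#|{: coord_pair n}|%:R : R).
Local Notation circle := (uniform_prob (two_pi_gt0 R)).

(* Every [kac_events k] contains the full space, so intersections over all
   indices of the past form a pi-system. *)
Definition past_events (N : nat) : set_system Omega :=
  [set A | exists2 E : nat + nat -> set Omega,
     (forall k, kac_events ij th k (E k)) &
     A = \bigcap_(k in [set` past_indices N]) E k].

Lemma kac_eventsT k : kac_events ij th k setT.
Proof. by case: k => s; exists setT => //; rewrite preimage_setT. Qed.

Lemma kac_eventsI k A B : kac_events ij th k A -> kac_events ij th k B ->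
  kac_events ij th k (A `&` B).
Proof.
by case: k => s [A' mA <-] [B' mB <-]; exists (A' `&` B') => //; exact: measurableI.
Qed.

Lemma measurable_kac_pair s (S : set (coord_pair n)) : measurable (ij s @^-1` S).
Proof.
rewrite (_ : _ @^-1` _ = \bigcup_(p in S) (ij s @^-1` [set p])); last first.
  apply/seteqP; split => [w Sw|w [p Sp /= wp]]; first by exists (ij s w).
  by rewrite /preimage/= wp.
apply: fin_bigcup_measurable => // p _.
exact: (kac_pair_measurable drive).
Qed.

Lemma measurable_kac_events k A : kac_events ij th k A -> measurable A.
Proof.
case: k => s [S mS <-]; first exact: measurable_kac_pair.
by rewrite -[X in measurable X]setTI; exact: measurable_funPT.
Qed.

Lemma past_eventsI N : setI_closed (past_events N).
Proof.
move=> _ _ [E kE ->] [F kF ->]; exists (fun k => E k `&` F k).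
  by move=> k; exact: kac_eventsI.
by rewrite bigcapI.
Qed.

Lemma past_eventsT N : past_events N setT.
Proof.
exists (fun=> setT); first exact: kac_eventsT.
by apply/seteqP; split.
Qed.

Lemma past_events_measurable N : past_events N `<=` measurable.
Proof.
move=> _ [E kE ->]; apply: fin_bigcap_measurable => // k _.
exact: measurable_kac_events (kE k).
Qed.

Lemma past_eventsE N k A : k \in past_indices N -> kac_events ij th k A ->
  past_events N A.
Proof.
move=> kN kA; exists (fun l => if l == k then A else setT).
  by move=> l; case: eqP => [->//|_]; exact: kac_eventsT.
apply/seteqP; split => [w Aw l _|w /(_ k kN)]; last by rewrite eqxx.
by case: eqP.
Qed.

(** The product rule is used twice: over all indices up to time [N], and over the past alone to
    reassemble [P A] from its factors. *)
Lemma past_events_indep N p A B : past_events N A -> measurable B ->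
  (P (A `&` (ij N @^-1` [set p] `&` theta N @^-1` B))
   = npairs^-1%:E * (P A * circle B))%E.
Proof.
move=> [E kE ->] mB.
have kD : kac_events ij th (inl N) (ij N @^-1` [set p]) by exists [set p].
have kB : kac_events ij th (inr N) (theta N @^-1` B) by exists B.
pose F k := if k == inl N then ij N @^-1` [set p]
  else if k == inr N then theta N @^-1` B else E k.
have kF k : kac_events ij th k (F k).
  by rewrite /F; case: eqP => [->//|_]; case: eqP => [->|].
have FE k : k \in past_indices N -> F k = E k.
  rewrite in_past_indices /F; case: k => s sN; rewrite ?(inj_eq inl_inj) ?(inj_eq inr_inj).
    by rewrite ltn_eqF.
  by rewrite ltn_eqF.
have FD : F (inl N) = ij N @^-1` [set p] by rewrite /F eqxx.
have FB : F (inr N) = theta N @^-1` B by rewrite /F/= eqxx.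
have := kac_independent drive (J := past_indices N.+1) (fun k _ => kF k).
have -> : \bigcap_(k in [set` past_indices N.+1]) F k =
    \bigcap_(k in [set` past_indices N]) E k `&` (ij N @^-1` [set p] `&` theta N @^-1` B).
  rewrite /= !set_fsetU1 !bigcap_setU1 FD FB setIA setIC.
  by congr (_ `&` _); apply: eq_bigcapr => k /FE.
have -> := kac_independent drive (J := past_indices N) (fun k _ => kE k).
rewrite /= => ->.
rewrite !big_fsetU1 ?inE/= ?in_past_indices ?ltnn//.
rewrite FD FB (kac_pair_uniform drive) -(kac_angle_uniform drive N mB).
rewrite [X in (_ = _ * X)%E]muleC; congr (_ * (_ * _))%E.
by apply: eq_big_seq => k /FE ->.
Qed.

Lemma measurable_walk N (x : 'M[R]_n) (u : 'cV[R]_n) k :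
  measurable_fun setT (fun w => (kac_walk ij th x N w *m u) k ord0).
Proof.
apply: (measurable_kac_walk (Z := fun w => w)) => [s p _|s _].
  exact: measurable_kac_pair.
exact: measurable_funPT.
Qed.

(** [Omega] with only the information of the first [N] pairs and angles. The identity map into it
    serves as the variable [Z] of [ge0_integral_indep], so no law on matrices is needed. *)
Let past N : measurableType _ := g_sigma_algebraType (past_events N).

Lemma measurable_walk_past N (x : 'M[R]_n) (u : 'cV[R]_n) k :
  measurable_fun setT
    (fun w : past N => (kac_walk ij th x N w *m u) k ord0).
Proof.
apply: (measurable_kac_walk (Z := fun w : past N => w : Omega)) => [s p sN|s sN].
  apply: sub_sigma_algebra; apply: (@past_eventsE N (inl s)).
    by rewrite in_past_indices.
  by exists [set p].
move=> _ B mB; rewrite setTI.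
apply: sub_sigma_algebra; apply: (@past_eventsE N (inr s)).
  by rewrite in_past_indices.
by exists B.
Qed.

Lemma measurable_dual_weights p (t : 'I_n -> R) k :
  measurable_fun setT (fun s : R => dual_weights p (cos (s *+ 2)) t k).
Proof.
rewrite /dual_weights; case: (_ || _); last exact: measurable_cst.
apply: measurable_funD => //; apply: measurable_funM => //.
exact: measurable_cos_double.
Qed.

Lemma measurable_dual_energy d' (T : measurableType d') (f : R -> \bar R)
    (p : coord_pair n) (t : 'I_n -> R) (v : T -> 'cV[R]_n) :
  measurable_fun setT f ->
  (forall k, measurable_fun setT (fun z => v z k ord0)) ->
  measurable_fun setT (fun zs : T * measurableTypeR R =>
    f (energy (dual_weights p (cos (zs.2 *+ 2)) t) (v zs.1))).
Proof.
move=> mf mv; apply: measurableT_comp => //; apply: measurable_energy => k.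
  exact: measurableT_comp (measurable_dual_weights p t k) measurable_snd.
exact: measurableT_comp (mv k) measurable_fst.
Qed.

Lemma measurable_rotation_energy d' (T : measurableType d') (f : R -> \bar R)
    (p : coord_pair n) (t : 'I_n -> R) (v : T -> 'cV[R]_n) :
  measurable_fun setT f ->
  (forall k, measurable_fun setT (fun z => v z k ord0)) ->
  measurable_fun setT (fun zs : T * measurableTypeR R =>
    f (energy t (rotation_mx (val p).1 (val p).2 zs.2 *m v zs.1))).
Proof.
move=> mf mv; apply: measurableT_comp => //; apply: measurable_energy => k //.
apply: measurable_rotation => // l.
exact: measurableT_comp (mv l) measurable_fst.
Qed.

(** Split [Omega] according to the N-th pair. On each piece the angle is independent of the past,
    and the duality of [integral_circle_energy] moves the step from the vector to the weights. *)
Lemma integral_kac_step (f : R -> \bar R) N (x : 'M[R]_n) (u : 'cV[R]_n)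
    (t : 'I_n -> R) :
  measurable_fun setT f -> (forall y, 0 <= f y)%E ->
  (\int[P]_w f (energy t (kac_walk ij th x N.+1 w *m u)) =
   \sum_(p : coord_pair n) (npairs^-1%:E * \int[circle]_s \int[P]_w
     f (energy (dual_weights p (cos (s *+ 2)) t) (kac_walk ij th x N w *m u))))%E.
Proof.
move=> mf f0.
have mU : measurable_fun setT (fun w => f (energy t (kac_walk ij th x N.+1 w *m u))).
  apply: measurableT_comp => //; apply: measurable_energy => k //.
  exact: measurable_walk.
pose D p := ij N @^-1` [set p].
have DT : setT = \big[setU/set0]_(p <- index_enum (coord_pair n)) D p.
  by apply/seteqP; split => // w _; rewrite (bigD1 (ij N w))//=; left.
rewrite [in LHS]DT ge0_integral_bigsetU//; last 4 first.
- by move=> p; exact: measurable_kac_pair.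
- exact: index_enum_uniq.
- by move=> p q _ _ [w [/= <- <-]].
- by rewrite -DT.
apply: eq_bigr => p _.
pose Z : Omega -> past N := fun w => w.
pose U w := kac_walk ij th x N w *m u.
pose H1 (z : past N * measurableTypeR R) :=
  f (energy t (rotation_mx (val p).1 (val p).2 z.2 *m U z.1)).
pose H2 (z : past N * measurableTypeR R) :=
  f (energy (dual_weights p (cos (z.2 *+ 2)) t) (U z.1)).
have mZ : measurable_fun setT Z.
  move=> _ Y mY; rewrite setTI.
  have sub : <<s past_events N >> `<=` @measurable _ Omega.
    apply: smallest_sub; [exact: sigma_algebra_measurable|exact: past_events_measurable].
  exact: sub.
have np0 : 0 < npairs by rewrite ltr0n; apply/card_gt0P; exists p.
transitivity (\int[P]_(w in D p) H1 (Z w, theta N w))%E.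
  apply: eq_integral => w; rewrite inE/= => wp.
  by rewrite /H1/= /U mulmxA -wp.
pose Q : probability (measurableTypeR R) R := circle.
apply: (@ge0_integral_indep _ _ Omega (past N) R P Z (past_events N) (D p)
  (theta N) Q npairs^-1 H1 H2 mZ erefl) => //.
- exact: past_eventsI.
- exact: past_eventsT.
- exact: measurable_kac_pair.
- by rewrite invr_gt0.
- by move=> A B; exact: past_events_indep.
- exact: (@measurable_rotation_energy _ (past N) f p t U mf
    (@measurable_walk_past N x u)).
- by move=> z; exact: f0.
- exact: (@measurable_dual_energy _ (past N) f p t U mf
    (@measurable_walk_past N x u)).
- by move=> z; exact: f0.
- move=> z; exact: (@integral_circle_energy R n f p t (U z) mf f0).
Qed.

(* [G N] dominates the N-th iterate of the dual averaging operator, started from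
   [f (energy t (x *m u))]. *)
Lemma integral_kac_walk_le (f : R -> \bar R) (x : 'M[R]_n) (u : 'cV[R]_n)
    (S : ('I_n -> R) -> Prop) (G : nat -> ('I_n -> R) -> R) :
  measurable_fun setT f -> (forall y, 0 <= f y)%E ->
  (forall p c t, `|c| <= 1 -> S t -> S (dual_weights p c t)) ->
  (forall t, S t -> (f (energy t (x *m u)) <= (G 0%N t)%:E)%E) ->
  (forall N t, S t -> exists a b c : coord_pair n -> R,
     (forall p y, `|y| <= 1 ->
        G N (dual_weights p y t) <= a p + b p * y + c p * y ^+ 2) /\
     \sum_p (a p + c p / 2) <= npairs * G N.+1 t) ->
  0 < npairs ->
  forall N t, S t ->
    (\int[P]_w f (energy t (kac_walk ij th x N w *m u)) <= (G N t)%:E)%E.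
Proof.
move=> mf f0 Sdual G0 GS np0; elim => [|N IH] t St.
  by rewrite /= integral_cst//= probability_setT mule1 G0.
rewrite integral_kac_step//.
have [a [b [c [Gle sumle]]]] := GS N t St.
apply: (@le_trans _ _ (\sum_(p : coord_pair n) (npairs^-1 * (a p + c p / 2))%:E)%E).
  apply: lee_sum => p _; rewrite EFinM; apply: lee_wpmul2l.
    by rewrite lee_fin invr_ge0 ltW.
  (* By induction the integrand is at most [G N] at the dual weights, hence at most a quadratic in
     cos (2 s), whose circle mean is [a p + c p / 2]. *)
  apply: (@integral_circle_trig _ _ _ (b p)).
  - have mE := @measurable_dual_energy _ Omega f p t
      (fun w => kac_walk ij th x N w *m u) mf (@measurable_walk N x u).
    exact: (measurable_fun_fubini_tonelli_G (m1 := P) _ mE (fun=> f0 _)).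
  - by move=> s; apply: integral_ge0.
  - move=> s; apply: (le_trans (IH _ (Sdual _ _ _ (cos_max _) St))).
    by rewrite lee_fin Gle// cos_max.
by rewrite sumEFin lee_fin -mulr_sumr ler_pdivrMl.
Qed.

End walk.

(** * Sums, squares and variance of the weights along a dual step *)

Section weights.
Context {R : realType} {n : nat}.
Implicit Types (t : 'I_n -> R) (p : coord_pair n).

Definition wsum t : R := \sum_k t k.
Definition wsqr t : R := \sum_k t k ^+ 2.
(** The sum of squared deviations of the weights from their mean. *)
Definition wvar t : R := wsqr t - wsum t ^+ 2 / n%:R.

Definition unit_weights t := forall k, 0 <= t k <= 1.

(** Both new entries equal the convex combination of the old ones with coefficients (1 + c) / 2 and
    (1 - c) / 2. *)
Lemma unit_dual_weights p c t :
  `|c| <= 1 -> unit_weights t -> unit_weights (dual_weights p c t).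
Proof.
rewrite ler_norml => /andP[c1 c2] t01 k; rewrite /dual_weights; case: ifP => // _.
have := t01 (val p).1; have := t01 (val p).2 => /andP[? ?] /andP[? ?].
by apply/andP; split; nra.
Qed.

Lemma wsum_dual p c t :
  wsum (dual_weights p c t) = wsum t + (t (val p).1 - t (val p).2) * c.
Proof.
rewrite /wsum !(sum_coord_pair p) /dual_weights !eqxx orbT/=.
rewrite [X in _ + X = _](eq_bigr t); last by move=> k /andP[/negbTE -> /negbTE ->].
by field.
Qed.

Lemma wsqr_dual p c t :
  wsqr (dual_weights p c t) = wsqr t
    + (t (val p).1 + t (val p).2) * (t (val p).1 - t (val p).2) * c
    - (t (val p).1 - t (val p).2) ^+ 2 * (1 - c ^+ 2) / 2.
Proof.
rewrite /wsqr !(sum_coord_pair p) /dual_weights !eqxx orbT/=.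
rewrite [X in _ + X = _](eq_bigr (fun k => t k ^+ 2)); last first.
  by move=> k /andP[/negbTE -> /negbTE ->].
by field.
Qed.

(** The double sum meets every unordered pair twice, and its diagonal vanishes. *)
Lemma sum_coord_pairs (F : 'I_n -> 'I_n -> R) :
  (forall i j, F i j = F j i) -> (forall i, F i i = 0) ->
  2 * (\sum_(p : coord_pair n) F (val p).1 (val p).2) = \sum_i \sum_j F i j.
Proof.
move=> Fsym F0.
have -> : \sum_(p : coord_pair n) F (val p).1 (val p).2
    = \sum_(q : 'I_n * 'I_n | (q.1 < q.2)%N) F q.1 q.2.
  rewrite [RHS](reindex_omap (val : coord_pair n -> _) insub).
    by apply: eq_bigl => p; rewrite valK eqxx andbT (valP p).
  by move=> q qlt; rewrite insubT.
rewrite pair_bigA/=.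
rewrite [RHS](bigID (fun q : 'I_n * 'I_n => (q.1 < q.2)%N))/= mulr_natl mulr2n.
congr (_ + _).
rewrite [RHS](bigID (fun q : 'I_n * 'I_n => q.1 == q.2))/=.
rewrite [X in _ = X + _]big1 ?add0r; last by move=> [i j] /= /andP[_ /eqP ->].
rewrite [RHS](reindex_inj (h := fun q : 'I_n * 'I_n => (q.2, q.1))); last first.
  by move=> [i j] [k l] [-> ->].
apply: eq_big => [[i j]|[i j] _] /=; last exact: Fsym.
by rewrite -leqNgt ltn_neqAle andbC eq_sym.
Qed.

Lemma card_coord_pair : 2 * (#|{: coord_pair n}|%:R : R) = n%:R * (n%:R - 1).
Proof.
have := @sum_coord_pairs (fun i j => (i != j)%:R).
have -> : \sum_(p : coord_pair n) ((val p).1 != (val p).2)%:R = #|{: coord_pair n}|%:R :> R.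
  rewrite (eq_bigr (fun=> 1)) ?sumr_const// => p _.
  by rewrite eq_sym coord_pair_neq.
move=> ->; first last.
- by move=> i; rewrite eqxx.
- by move=> i j; rewrite eq_sym.
rewrite (eq_bigr (fun=> n%:R - 1)); first by rewrite sumr_const card_ord mulr_natl.
move=> i _; rewrite (eq_bigr (fun j => 1 - (j == i)%:R)); last first.
  by move=> j _; rewrite eq_sym; case: (j == i); rewrite ?subrr ?subr0.
rewrite sumrB sumr_const card_ord; congr (_ - _).
by rewrite (bigD1 i)//= eqxx big1 ?addr0// => j /negbTE ->.
Qed.

(** Converts the decrease per pair, a multiple of the squared difference, into a multiple of the
    variance once the pair is averaged. *)
Lemma sum_sqr_diff t : (0 < n)%N ->
  \sum_(p : coord_pair n) (t (val p).1 - t (val p).2) ^+ 2 = n%:R * wvar t.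
Proof.
move=> n0; have nn0 : n%:R != 0 :> R by rewrite pnatr_eq0 -lt0n.
apply: (@mulfI _ 2); first by rewrite pnatr_eq0.
rewrite (@sum_coord_pairs (fun i j => (t i - t j) ^+ 2)); first last.
- by move=> i; rewrite subrr expr0n.
- by move=> i j; rewrite -sqrrN opprB.
transitivity (\sum_i (n%:R * t i ^+ 2 - 2 * wsum t * t i + wsqr t)).
  apply: eq_bigr => i _.
  rewrite (eq_bigr (fun j => t i ^+ 2 - 2 * t i * t j + t j ^+ 2)); last first.
    by move=> j _; ring.
  rewrite big_split/= sumrB sumr_const card_ord -mulr_sumr -/(wsqr t) -/(wsum t).
  by ring.
rewrite big_split/= sumrB sumr_const card_ord -!mulr_sumr -/(wsqr t) -/(wsum t).
by rewrite /wvar; field.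
Qed.

Lemma wvar_ge0 t : (0 < n)%N -> 0 <= wvar t.
Proof.
move=> n0; rewrite -(pmulr_rge0 _ (_ : 0 < n%:R)) ?ltr0n// -sum_sqr_diff//.
by apply: sumr_ge0 => p _; exact: sqr_ge0.
Qed.

(** From exp (- w) >= 1 - w one gets exp w <= 1 / (1 - w), and (1 + w + 2 w^2) (1 - w) = 1 + w^2 (1
    - 2 w) >= 1. *)
Lemma expR_le_quadratic (w : R) : w <= 2^-1 -> expR w <= 1 + w + 2 * w ^+ 2.
Proof.
move=> w2; have w1 : 0 < 1 - w by lra.
rewrite -[expR w]invrK -expRN; apply: (@le_trans _ _ (1 - w)^-1).
  by rewrite lef_pV2 ?posrE ?expR_gt0// expR_ge1Dx.
rewrite -[leLHS]mul1r ler_pdivrMr//.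
have : 0 <= w ^+ 2 * (1 - 2 * w) by rewrite mulr_ge0 ?sqr_ge0//; lra.
by move=> H; apply: (le_trans (y := 1 + w ^+ 2 * (1 - 2 * w))); [lra|nra].
Qed.

(* Along a dual step al * wsum moves by a fluctuating amount whose exponential
   moment is compensated by the systematic decrease of be * wsqr. *)
Lemma expR_dual p c t (al be : R)
    (D := t (val p).1 - t (val p).2)
    (a := al + be * (t (val p).1 + t (val p).2))
    (E := expR (al * wsum t + be * wsqr t)) :
  unit_weights t -> `|c| <= 1 -> `|al| <= 320^-1 -> be = 40 * al ^+ 2 ->
  expR (al * wsum (dual_weights p c t) + be * wsqr (dual_weights p c t))
  <= E * (1 + D ^+ 2 * (be ^+ 2 - be / 2)) + E * (a * D) * c
     + E * (D ^+ 2 * (be / 2 - be ^+ 2 + 4 * a ^+ 2)) * c ^+ 2.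
Proof.
move=> t01 c1 al1 beE.
(* The increment of the exponent: a fluctuation linear in [c] minus the systematic decrease of
   [be * wsqr]. *)
pose w := a * D * c - be / 2 * (D ^+ 2 * (1 - c ^+ 2)).
have -> : al * wsum (dual_weights p c t) + be * wsqr (dual_weights p c t)
    = (al * wsum t + be * wsqr t) + w.
  by rewrite wsum_dual wsqr_dual /w /a /D; field.
rewrite expRD -/E.
have := t01 (val p).1; have := t01 (val p).2 => /andP[t20 t21] /andP[t10 t11].
have be0 : 0 <= be by rewrite beE mulr_ge0// sqr_ge0.
have D1 : `|D| <= 1 by rewrite ler_norml /D; apply/andP; split; lra.
have D2 : D ^+ 2 <= 1 by rewrite -real_normK ?num_real// expr_le1.
have c2 : c ^+ 2 <= 1 by rewrite -real_normK ?num_real// expr_le1.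
have [D20 c20] := (sqr_ge0 D, sqr_ge0 c).
have al2 : be <= `|al|.
  rewrite beE -real_normK ?num_real// expr2 mulrA; apply: ler_piMl => //.
  have : 40 * `|al| <= 40 * 320^-1 by apply: ler_wpM2l al1.
  lra.
have a1 : `|a| <= 3 / 320.
  rewrite (le_trans (ler_normD _ _))// normrM (ger0_norm be0).
  rewrite (ger0_norm (_ : 0 <= t (val p).1 + t (val p).2)); last lra.
  by nra.
have wle : w <= 2^-1.
  have : `|a * D * c| <= 3 / 320.
    rewrite !normrM (le_trans _ a1)// -mulrA; apply: ler_piMr => //.
    by rewrite mulr_ile1.
  rewrite ler_norml /w => /andP[_ h].
  have : 0 <= be / 2 * (D ^+ 2 * (1 - c ^+ 2)).
    by rewrite mulr_ge0 ?divr_ge0// mulr_ge0// subr_ge0.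
  lra.
have -> : E * (1 + D ^+ 2 * (be ^+ 2 - be / 2)) + E * (a * D) * c
     + E * (D ^+ 2 * (be / 2 - be ^+ 2 + 4 * a ^+ 2)) * c ^+ 2
  = E * (1 + w + (4 * (a * D * c) ^+ 2 + be ^+ 2 * (D ^+ 2 * (1 - c ^+ 2)))).
  by rewrite /w; field.
apply: ler_wpM2l; first exact: expR_ge0.
rewrite (le_trans (expR_le_quadratic wle))// lerD2l.
(* With w = X - be Y / 2 and 0 <= Y <= 1, one has 2 w^2 <= 4 X^2 + be^2 Y^2 <= 4 X^2 + be^2 Y; the
   first inequality is the nonnegativity of (X + be Y / 2)^2. *)
set X := a * D * c; set Y := D ^+ 2 * (1 - c ^+ 2).
have Y0 : 0 <= Y by rewrite mulr_ge0// subr_ge0.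
have Y1 : Y <= 1 by rewrite mulr_ile1 ?subr_ge0//; lra.
have : Y ^+ 2 <= Y by rewrite expr2 ler_piMl.
have -> : w = X - be / 2 * Y by [].
have := sqr_ge0 (X + be / 2 * Y); have := sqr_ge0 be => b2 h1 h2.
have : be ^+ 2 * Y ^+ 2 <= be ^+ 2 * Y by apply: ler_wpM2l.
nra.
Qed.

(** The supermartingale property: with mean 0 for [c] and 1/2 for its square, the factor is 1 + D^2
    (be^2 / 2 - be / 4 + 2 a^2). Since a^2 <= 2 al^2 = be / 20 and [be] is tiny, the term - be / 4
    dominates. *)
Lemma expR_dual_mean p t (al be : R)
    (D := t (val p).1 - t (val p).2)
    (a := al + be * (t (val p).1 + t (val p).2)) :
  unit_weights t -> `|al| <= 320^-1 -> be = 40 * al ^+ 2 ->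
  (1 + D ^+ 2 * (be ^+ 2 - be / 2)) + D ^+ 2 * (be / 2 - be ^+ 2 + 4 * a ^+ 2) / 2 <= 1.
Proof.
move=> t01 al1 beE.
have := t01 (val p).1; have := t01 (val p).2 => /andP[t20 t21] /andP[t10 t11].
have -> : 1 + D ^+ 2 * (be ^+ 2 - be / 2) + D ^+ 2 * (be / 2 - be ^+ 2 + 4 * a ^+ 2) / 2
  = 1 + D ^+ 2 * (be ^+ 2 / 2 - be / 4 + 2 * a ^+ 2) by field.
rewrite gerDl mulr_ge0_le0 ?sqr_ge0//.
set u := t (val p).1 + t (val p).2 in a *.
have u0 : 0 <= u by rewrite /u; lra.
have u2 : u <= 2 by rewrite /u; lra.
have aE : a = al * (1 + 40 * al * u) by rewrite /a beE; ring.
have h : `|40 * al * u| <= 4^-1.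
  rewrite !normrM (ger0_norm u0) (ger0_norm (_ : 0 <= 40))//.
  have : `|al| * u <= 320^-1 * 2 by apply: ler_pM.
  rewrite -mulrA; lra.
have a2 : a ^+ 2 <= al ^+ 2 * 2.
  rewrite aE exprMn; apply: ler_wpM2l; first exact: sqr_ge0.
  by move: h; rewrite ler_norml => /andP[h1 h2]; nra.
have al2 : al ^+ 2 <= 320^-1 ^+ 2.
  by move: al1; rewrite ler_norml => /andP[l1 l2]; nra.
have b1 : be <= 1.
  by rewrite beE; lra.
have be0 : 0 <= be by rewrite beE mulr_ge0// sqr_ge0.
have : be ^+ 2 <= be * (40 * (320^-1 ^+ 2)).
  by rewrite expr2 {2}beE; apply: ler_wpM2l => //; apply: ler_wpM2l.
have : 0 <= al ^+ 2 := sqr_ge0 al.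
move: beE; lra.
Qed.

Lemma wvar_dual p c t (D := t (val p).1 - t (val p).2) :
  (0 < n)%N ->
  wvar (dual_weights p c t) = (wvar t - D ^+ 2 / 2)
    + ((t (val p).1 + t (val p).2) * D - 2 * wsum t * D / n%:R) * c
    + (D ^+ 2 / 2 - D ^+ 2 / n%:R) * c ^+ 2.
Proof.
move=> n0; have nn0 : n%:R != 0 :> R by rewrite pnatr_eq0 -lt0n.
by rewrite /wvar wsum_dual wsqr_dual /D; field.
Qed.

End weights.

(** * The deviation probability for one unit vector *)

Section tail.
Local Open Scope classical_set_scope.
Context {R : realType} {n : nat}.
Implicit Types (t : 'I_n -> R) (u v : 'cV[R]_n).

(** The squared coordinates of [v] form a probability vector, under which the energy is the mean of
    [t]. Jensen bounds the squared difference by a weighted sum of squared deviations, and each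
    weight is at most 1. *)
Lemma energy_mean_le t v : (0 < n)%N -> \sum_k v k ord0 ^+ 2 = 1 ->
  (energy t v - wsum t / n%:R) ^+ 2 <= wvar t.
Proof.
move=> n0 v1; have nn0 : n%:R != 0 :> R by rewrite pnatr_eq0 -lt0n.
set m := wsum t / n%:R; set e := energy t v - m.
have wvarE : wvar t = \sum_k (t k - m) ^+ 2.
  transitivity (\sum_k (t k ^+ 2 - 2 * m * t k + m ^+ 2)); last first.
    by apply: eq_bigr => k _; ring.
  rewrite big_split/= sumrB sumr_const card_ord -mulr_sumr -/(wsqr t) -/(wsum t).
  by rewrite /wvar /m; field.
have eE : \sum_k v k ord0 ^+ 2 * (t k - m) = e.
  rewrite /e -[m in RHS]mulr1 -v1 mulr_sumr -sumrB.
  by apply: eq_bigr => k _; ring.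
have jensen : 0 <= \sum_k v k ord0 ^+ 2 * (t k - m - e) ^+ 2.
  by apply: sumr_ge0 => k _; rewrite mulr_ge0 ?sqr_ge0.
have jensenE : \sum_k v k ord0 ^+ 2 * (t k - m - e) ^+ 2
    = \sum_k v k ord0 ^+ 2 * (t k - m) ^+ 2 - e ^+ 2.
  transitivity (\sum_k (v k ord0 ^+ 2 * (t k - m) ^+ 2
      - 2 * e * (v k ord0 ^+ 2 * (t k - m)) + e ^+ 2 * v k ord0 ^+ 2)).
    by apply: eq_bigr => k _; ring.
  rewrite big_split/= sumrB -!mulr_sumr eE v1; ring.
rewrite wvarE (le_trans (y := \sum_k v k ord0 ^+ 2 * (t k - m) ^+ 2))//.
  by rewrite -subr_ge0 -jensenE.
apply: ler_sum => k _; apply: ler_piMl; first exact: sqr_ge0.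
by rewrite -v1 (bigD1 k)//= lerDl sumr_ge0// => j _; exact: sqr_ge0.
Qed.

(** The initial weights: their energy is the squared norm of the projection onto the first [l]
    coordinates. *)
Definition first_weights (l : nat) : 'I_n -> R := fun k => (k < l)%:R.

Lemma wsum_first_weights l : (l <= n)%N -> wsum (first_weights l) = l%:R.
Proof.
move=> ln; rewrite /wsum /first_weights.
rewrite -[in RHS](card_ord l) -sum1_card natr_sum (big_ord_widen n (fun=> 1))//.
by rewrite [RHS]big_mkcond/=; apply: eq_bigr => k _; case: ifP.
Qed.

Lemma wsqr_first_weights l : (l <= n)%N -> wsqr (first_weights l) = l%:R.
Proof.
move=> ln; rewrite -(wsum_first_weights ln); apply: eq_bigr => k _.
by rewrite /first_weights -natrX; case: (k < l)%N.
Qed.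

Lemma unit_first_weights l : unit_weights (first_weights l).
Proof. by move=> k; rewrite /first_weights; case: (k < l)%N; rewrite ?lexx ?ler01. Qed.

Section supersolution.
Variables (eps : R) (l : nat).
(** Here [be] is 40 [al]^2, and eps < 1/2 gives al < 1/320. The number [rho] is the contraction rate
    of the variance, and [B] is the inverse square of the deviation (eps / 2) (l / n). *)
Let al : R := eps / 160.
Let be : R := eps ^+ 2 / 640.
Let rho : R := 1 - (2 * n%:R)^-1.
Let B : R := 4 * n%:R ^+ 2 / (eps ^+ 2 * l%:R ^+ 2).

(* The three terms handle a mean weight that is too large, a mean weight that is
   too small, and weights that are not yet equalized. *)
Definition tail_bound (N : nat) t : R :=
  expR (- (al * l%:R * (1 + eps / 2))) * expR (al * wsum t + be * wsqr t)
  + expR (al * l%:R * (1 - eps / 2)) * expR (- al * wsum t + be * wsqr t)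
  + B * rho ^+ N * wvar t.

Definition deviation : set R := [set s | eps * (l%:R / n%:R) < `|s - l%:R / n%:R|].

Hypotheses (eps_gt0 : 0 < eps) (eps_lt : eps < 2^-1) (l_gt0 : (0 < l)%N)
  (n_gt1 : (1 < n)%N).

Let n_gt0 : (0 < n)%N. Proof. exact: ltnW. Qed.
Let nR : 2 <= n%:R :> R. Proof. by rewrite ler_nat. Qed.
Let lR : 0 < l%:R :> R. Proof. by rewrite ltr0n. Qed.

Lemma measurable_deviation : measurable deviation.
Proof.
have md : measurable_fun setT (fun s : R => `|s - l%:R / n%:R|).
  by apply: measurableT_comp => //; exact: measurable_funB.
have := md measurableT _ (measurable_itv `](eps * (l%:R / n%:R)), +oo[%R).
rewrite setTI; congr (measurable _).
by apply/seteqP; split => s /=; rewrite in_itv/= andbT.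
Qed.

Let rho_ge0 : 0 <= rho.
Proof.
rewrite /rho subr_ge0 invf_le1 ?mulr_gt0 ?ltr0n//; by have := nR; lra.
Qed.

(** On a deviation, the mean weight is off by the relative amount eps / 2, upwards or downwards, or
    else the energy is that far from the mean weight. In each case one of the three terms is at
    least 1. *)
Lemma tail_bound0 t v : unit_weights t -> \sum_k v k ord0 ^+ 2 = 1 ->
  \1_deviation (energy t v) <= tail_bound 0 t.
Proof.
move=> t01 v1; rewrite indicE.
have V0 : 0 <= wvar t by exact: wvar_ge0.
have B0 : 0 <= B by rewrite divr_ge0// mulr_ge0// ?sqr_ge0.
have Q0 : 0 <= wsqr t by apply: sumr_ge0 => k _; exact: sqr_ge0.
have be0 : 0 <= be by rewrite /be; have := sqr_ge0 eps; lra.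
have al0 : 0 < al by rewrite /al; have := eps_gt0; lra.
rewrite /tail_bound expr0 mulr1 -!expRD.
set X := expR _; set Y := expR _; have [X0 Y0] : 0 <= X /\ 0 <= Y by rewrite !expR_ge0.
have BV0 : 0 <= B * wvar t by rewrite mulr_ge0.
case: (boolP (_ \in _)) => [|_]; last by rewrite !addr_ge0.
rewrite inE /deviation/= => dev.
have := energy_mean_le t n_gt0 v1.
set m := wsum t / n%:R => mle.
have nn0 : n%:R != 0 :> R by rewrite pnatr_eq0 -lt0n.
have mE : wsum t = n%:R * m by rewrite /m mulrC divfK.
set q := l%:R / n%:R in dev *.
have qE : l%:R = n%:R * q by rewrite /q mulrC divfK.
have q0 : 0 < q by rewrite divr_gt0// ltr0n.
have bQ : 0 <= be * wsqr t by rewrite mulr_ge0.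
have aN : 0 < al * n%:R by rewrite mulr_gt0// ltr0n.
have [mbig|msmall] := leP (q * (1 + eps / 2)) m.
  have : 1 <= X; last by lra.
  rewrite -[leLHS]expR0 /X ler_expR mE qE.
  have : 0 <= al * n%:R * (m - q * (1 + eps / 2)) by rewrite mulr_ge0 ?subr_ge0// ltW.
  lra.
have [mbig|mbig] := leP m (q * (1 - eps / 2)).
  have : 1 <= Y; last by lra.
  rewrite -[leLHS]expR0 /Y ler_expR mE qE.
  have : 0 <= al * n%:R * (q * (1 - eps / 2) - m) by rewrite mulr_ge0 ?subr_ge0// ltW.
  lra.
(* In the remaining case the triangle inequality leaves eps q / 2 for the distance from the energy
   to [m], so the variance is at least 1 / B. *)
have dm : `|m - q| <= eps / 2 * q by rewrite ler_norml; apply/andP; split; lra.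
have em : eps / 2 * q <= `|energy t v - m|.
  have := ler_normB (energy t v - q) (m - q).
  have := ler_normD (energy t v - m) (m - q).
  rewrite subrKA => h _; lra.
have Vbig : (eps / 2 * q) ^+ 2 <= wvar t.
  rewrite (le_trans _ mle)// -[leRHS]real_normK ?num_real//.
  have eq0 : 0 <= eps / 2 * q by apply: mulr_ge0; [apply: divr_ge0|]; rewrite // ltW.
  by apply: lerXn2r; rewrite ?nnegrE.
have : 1 <= B * wvar t; last by lra.
rewrite (le_trans _ (ler_wpM2l B0 Vbig))// /B /q.
rewrite le_eqVlt; apply/orP; left; apply/eqP; field.
by rewrite nn0 !gt_eqF.
Qed.

(** Each term is handled separately: the exponential ones do not grow in mean for any single pair,
    while the variance term contracts after averaging over the pairs. *)
Lemma tail_boundS N t : unit_weights t -> exists a b c : coord_pair n -> R,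
  (forall p y, `|y| <= 1 ->
    tail_bound N (dual_weights p y t) <= a p + b p * y + c p * y ^+ 2) /\
  \sum_p (a p + c p / 2) <= #|{: coord_pair n}|%:R * tail_bound N.+1 t.
Proof.
move=> t01.
have nn0 : n%:R != 0 :> R by rewrite pnatr_eq0 -lt0n.
have B0 : 0 <= B by rewrite divr_ge0// mulr_ge0// ?sqr_ge0.
have BN0 : 0 <= B * rho ^+ N by rewrite mulr_ge0// exprn_ge0.
have al1 : `|al| <= 320^-1 by rewrite ger0_norm /al; have := eps_lt; have := eps_gt0; lra.
have Nal1 : `|- al| <= 320^-1 by rewrite normrN.
have beE : be = 40 * al ^+ 2 by rewrite /be /al; field.
have NbeE : be = 40 * (- al) ^+ 2 by rewrite sqrrN.
pose D (p : coord_pair n) := t (val p).1 - t (val p).2.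
pose a (s : R) (p : coord_pair n) := s + be * (t (val p).1 + t (val p).2).
pose E s := expR (s * wsum t + be * wsqr t).
pose c1 := expR (- (al * l%:R * (1 + eps / 2))).
pose c2 := expR (al * l%:R * (1 - eps / 2)).
pose A p := 1 + D p ^+ 2 * (be ^+ 2 - be / 2).
pose C s p := D p ^+ 2 * (be / 2 - be ^+ 2 + 4 * a s p ^+ 2).
have [c10 c20] : 0 <= c1 /\ 0 <= c2 by rewrite !expR_ge0.
have E0 s : 0 <= E s by exact: expR_ge0.
(* The coefficients are read off from [expR_dual], for [al] and for [- al], and from [wvar_dual]. *)
exists (fun p => c1 * (E al * A p) + c2 * (E (- al) * A p)
    + B * rho ^+ N * (wvar t - D p ^+ 2 / 2)).
exists (fun p => c1 * (E al * (a al p * D p)) + c2 * (E (- al) * (a (- al) p * D p))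
    + B * rho ^+ N * ((t (val p).1 + t (val p).2) * D p - 2 * wsum t * D p / n%:R)).
exists (fun p => c1 * (E al * C al p) + c2 * (E (- al) * C (- al) p)
    + B * rho ^+ N * (D p ^+ 2 / 2 - D p ^+ 2 / n%:R)).
split=> [p y y1|].
  have h1 := ler_wpM2l c10 (expR_dual p t01 y1 al1 beE).
  have h2 := ler_wpM2l c20 (expR_dual p t01 y1 Nal1 NbeE).
  rewrite /tail_bound -/c1 -/c2 wvar_dual//.
  apply: (le_trans (lerD (lerD h1 h2) (lexx _))).
  rewrite le_eqVlt; apply/orP; left; apply/eqP; rewrite /A /C /E /a /D; ring.
have mean p : c1 * (E al * A p) + c2 * (E (- al) * A p)
      + B * rho ^+ N * (wvar t - D p ^+ 2 / 2)
      + (c1 * (E al * C al p) + c2 * (E (- al) * C (- al) p)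
        + B * rho ^+ N * (D p ^+ 2 / 2 - D p ^+ 2 / n%:R)) / 2
   <= c1 * E al + c2 * E (- al)
      + B * rho ^+ N * (wvar t - (4^-1 + (2 * n%:R)^-1) * D p ^+ 2).
  have h1 : c1 * (E al * (A p + C al p / 2)) <= c1 * E al.
    by rewrite ler_wpM2l// ler_piMr//; exact: expR_dual_mean t01 al1 beE.
  have h2 : c2 * (E (- al) * (A p + C (- al) p / 2)) <= c2 * E (- al).
    by rewrite ler_wpM2l// ler_piMr//; exact: expR_dual_mean t01 Nal1 NbeE.
  apply: (le_trans _ (lerD (lerD h1 h2) (lexx _))).
  by rewrite le_eqVlt; apply/orP; left; apply/eqP; field.
apply: (le_trans (ler_sum _ (fun p _ => mean p))).
rewrite big_split/= sumr_const -mulr_sumr sumrB sumr_const -mulr_sumr sum_sqr_diff//.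
rewrite /tail_bound -/c1 -/c2 -/(E al) -/(E (- al)).
set m := #|{: coord_pair n}|.
have cardE := @card_coord_pair R n; rewrite -/m in cardE.
have V0 : 0 <= wvar t by exact: wvar_ge0.
rewrite -[wvar t *+ m]mulr_natl [leRHS]mulrDr.
rewrite [m%:R * (c1 * _ + _)]mulr_natl lerD2l exprS.
have mE : m%:R = n%:R * (n%:R - 1) / 2 :> R by rewrite -cardE; field.
rewrite [leRHS](_ : _ = B * rho ^+ N * (m%:R * (rho * wvar t))); last by ring.
rewrite ler_wpM2l// mE /rho -subr_ge0.
(* The pairs remove (n / 4 + 1/2) times the variance, while the rate [rho] asks for m / (2 n) = (n -
   1) / 4 times; the slack is 3/4. *)
set LHS := (X in 0 <= X).
have -> : LHS = wvar t * (3 / 4) by rewrite /LHS; field.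
by rewrite mulr_ge0// divr_ge0.
Qed.

(** At 0-1 weights [wsum] and [wsqr] both equal l, so both exponents become eps^2 l (1/640 - 1/320),
    and the variance is at most l. *)
Lemma tail_bound_first (N : nat) : (l <= n)%N ->
  tail_bound N (first_weights l) <= 2 * expR (- (eps ^+ 2 * l%:R / 640))
    + 4 * n%:R ^+ 2 / (eps ^+ 2 * l%:R) * expR (- (N%:R / (2 * n%:R))).
Proof.
move=> ln; rewrite /tail_bound /wvar wsum_first_weights// wsqr_first_weights//.
have nn0 : n%:R != 0 :> R by rewrite pnatr_eq0 -lt0n.
have l0 : l%:R != 0 :> R by rewrite gt_eqF.
rewrite -!expRD.
have -> : - (al * l%:R * (1 + eps / 2)) + (al * l%:R + be * l%:R)
    = - (eps ^+ 2 * l%:R / 640) by rewrite /al /be; field.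
have -> : al * l%:R * (1 - eps / 2) + (- al * l%:R + be * l%:R)
    = - (eps ^+ 2 * l%:R / 640) by rewrite /al /be; field.
rewrite -mulr2n -[_ *+ 2]mulr_natl lerD2l.
have B0 : 0 <= B by rewrite divr_ge0// mulr_ge0// ?sqr_ge0.
have rhoN : rho ^+ N <= expR (- (N%:R / (2 * n%:R))).
  rewrite (_ : - _ = N%:R * - (2 * n%:R)^-1); last by field.
  rewrite expRM_natl lerXn2r ?nnegrE ?expR_ge0//.
  exact: expR_ge1Dx.
rewrite -mulrA mulrCA [leRHS]mulrC; apply: ler_pM => //.
- by rewrite exprn_ge0.
- apply: mulr_ge0 B0 _.
  rewrite subr_ge0 ler_pdivrMr ?ltr0n// expr2 ler_wpM2l ?ler_nat//; exact: ltW.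
rewrite (_ : 4 * n%:R ^+ 2 / (eps ^+ 2 * l%:R) = B * l%:R); last first.
  by rewrite /B; field; rewrite l0 gt_eqF.
by apply: (ler_wpM2l B0); rewrite gerBl divr_ge0// sqr_ge0.
Qed.

(** The probability is the integral of an indicator evaluated at the energy, and [tail_bound] is a
    family of dominating functions as demanded by [integral_kac_walk_le]. *)
Lemma kac_deviation (d : measure_display) (Omega : measurableType d)
    (P : probability Omega R) (ij : nat -> Omega -> coord_pair n)
    (theta : nat -> {RV P >-> R}) (x : 'M[R]_n) u (N : nat) :
  kac_driving ij theta -> (l <= n)%N -> \sum_k (x *m u) k ord0 ^+ 2 = 1 ->
  let F := [set w | deviation (energy (first_weights l)
    (kac_walk ij (fun s => theta s : Omega -> R) x N w *m u))] in
  measurable F /\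
  (P F <= (2 * expR (- (eps ^+ 2 * l%:R / 640))
    + 4 * n%:R ^+ 2 / (eps ^+ 2 * l%:R) * expR (- (N%:R / (2 * n%:R))))%:E)%E.
Proof.
move=> drive ln xu1 F.
pose e w := energy (first_weights l)
  (kac_walk ij (fun s => theta s : Omega -> R) x N w *m u).
have me : measurable_fun setT e.
  by apply: measurable_energy => k //; exact: measurable_walk.
have mF : measurable F.
  by have := me measurableT _ measurable_deviation; rewrite setTI.
split => //.
have -> : P F = (\int[P]_w (\1_deviation (e w))%:E)%E.
  by rewrite -[F]setIT -integral_indic.
apply: (@le_trans _ _ (tail_bound N (first_weights l))%:E); last first.
  by rewrite lee_fin tail_bound_first.
apply: (integral_kac_walk_le drive (f := fun s => (\1_deviation s)%:E)
  (S := unit_weights)) => //.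
- by apply/measurable_EFinP; exact: measurable_indic measurable_deviation.
- by move=> p c t; exact: unit_dual_weights.
- by move=> t t01; rewrite lee_fin; exact: tail_bound0.
- by move=> M t t01; exact: tail_boundS.
- by rewrite -(pmulr_rgt0 _ (_ : 0 < 2))// card_coord_pair mulr_gt0; have := nR; lra.
- exact: unit_first_weights.
Qed.

End supersolution.

End tail.

(** * From one vector to all pairs of points *)

Section johnson_lindenstrauss.
Local Open Scope classical_set_scope.
Context {R : realType}.

Lemma l2normK m (v : 'cV[R]_m) : l2norm v ^+ 2 = \sum_k v k ord0 ^+ 2.
Proof. by rewrite sqr_sqrtr// sumr_ge0// => k _; exact: sqr_ge0. Qed.

Lemma sum_sqr_orthogonal n (x : 'M[R]_n) (u : 'cV[R]_n) : special_orthogonal x ->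
  \sum_k (x *m u) k ord0 ^+ 2 = \sum_k u k ord0 ^+ 2.
Proof.
move=> [/mulmx1C xTx _].
have sqE (v : 'cV[R]_n) : \sum_k v k ord0 ^+ 2 = (v^T *m v) ord0 ord0.
  by rewrite mxE; apply: eq_bigr => k _; rewrite mxE expr2.
by rewrite !sqE trmx_mul -mulmxA (mulmxA x^T) xTx mul1mx.
Qed.

Lemma l2norm_jl_matrix n l (G : 'M[R]_n) (z : 'cV[R]_n) : (l <= n)%N ->
  l2norm (jl_matrix l G *m z) ^+ 2
  = n%:R / l%:R * energy (first_weights l) (G *m z).
Proof.
move=> ln; rewrite l2normK /jl_matrix -scalemxAl -mulmxA.
set y := G *m z.
have pidE (i : 'I_l) : (pid_mx l *m y) i ord0 = y (widen_ord ln i) ord0.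
  rewrite mxE (bigD1 (widen_ord ln i))//= big1 ?addr0 => [|j ji].
    by rewrite mxE eqxx ltn_ord mul1r.
  rewrite mxE; case: eqP => [ij|_]; last by rewrite mul0r.
  by case/eqP: ji; apply: val_inj.
transitivity (\sum_(i < l) n%:R / l%:R * y (widen_ord ln i) ord0 ^+ 2).
  apply: eq_bigr => i _; rewrite mxE exprMn sqr_sqrtr ?divr_ge0//.
  by rewrite pidE.
rewrite -mulr_sumr; congr (_ * _).
rewrite -(big_ord_narrow ln (F := fun k => y k ord0 ^+ 2)) big_mkcond/=.
by apply: eq_bigr => k _; rewrite /first_weights; case: ifP; rewrite ?mul1r ?mul0r.
Qed.

Lemma energyZ n (t : 'I_n -> R) (c : R) (v : 'cV[R]_n) :
  energy t (c *: v) = c ^+ 2 * energy t v.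
Proof.
rewrite /energy mulr_sumr; apply: eq_bigr => k _.
by rewrite mxE; ring.
Qed.

(** After division by c^2, distortion at most eps says that the energy lies within a factor 1 +- eps
    of l / n. *)
Lemma jl_deviation n l (eps : R) (G : 'M[R]_n) (u : 'cV[R]_n) (c : R) :
  (0 < l)%N -> (l <= n)%N -> 0 < c -> \sum_k u k ord0 ^+ 2 = 1 ->
  ((1 - eps) * l2norm (c *: u) ^+ 2 <= l2norm (jl_matrix l G *m (c *: u)) ^+ 2
    <= (1 + eps) * l2norm (c *: u) ^+ 2) <->
  ~ deviation (n := n) eps l (energy (first_weights l) (G *m u)).
Proof.
move=> l0 ln c0 u1.
have n0 : (0 < n)%N by exact: leq_trans ln.
have lR : 0 < l%:R :> R by rewrite ltr0n.
have nR : 0 < n%:R :> R by rewrite ltr0n.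
rewrite l2norm_jl_matrix// -scalemxAr energyZ.
have -> : l2norm (c *: u) ^+ 2 = c ^+ 2.
  rewrite l2normK -[RHS]mulr1 -u1 mulr_sumr; apply: eq_bigr => k _.
  by rewrite mxE; ring.
have c20 : 0 < c ^+ 2 by rewrite exprn_gt0.
rewrite /deviation /=; set e := energy _ _.
set q := l%:R / n%:R; have q0 : 0 < q by rewrite divr_gt0.
have -> : n%:R / l%:R * (c ^+ 2 * e) = e / q * c ^+ 2.
  by rewrite /q; field; rewrite !gt_eqF.
rewrite !ler_pM2r// ler_pdivlMr// ler_pdivrMr//.
split => [/andP[h1 h2]|/negP].
  by apply/negP; rewrite -leNgt ler_norml; apply/andP; split; lra.
by rewrite -leNgt ler_norml => /andP[h1 h2]; apply/andP; split; lra.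
Qed.

Lemma measure_bigsetU_le d (T : measurableType d) (mu : {measure set T -> \bar R})
    (I : Type) (s : seq I) (F : I -> set T) :
  (forall i, measurable (F i)) ->
  (mu (\big[setU/set0]_(i <- s) F i) <= \sum_(i <- s) mu (F i))%E.
Proof.
move=> mF; elim: s => [|i s IH]; first by rewrite !big_nil measure0.
rewrite !big_cons; apply: le_trans (measureU2 _ _ _) _ => //.
  by apply: bigsetU_measurable.
exact: leeD2l.
Qed.

(** Put q = delta / N. The constants 2560 = 4 * 640 and 8 = 4 * 2 make the exponentials at most q^4
    and q^4 / n^4; the latter absorbs the prefactor 4 n^2. The total is at most 6 q^4 <= q^2 / delta
    = delta / N^2, because q <= 1/4. *)
Lemma pair_bound (n N : nat) (eps delta : R) (l T : nat) :
  (1 < n)%N -> (2 <= N)%N -> 0 < eps -> 0 < delta < 2^-1 -> (0 < l)%N ->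
  2560 * ln (N%:R / delta) <= eps ^+ 2 * l%:R ->
  8 * n%:R * (ln n%:R + ln (N%:R / delta)) <= T%:R ->
  2 * expR (- (eps ^+ 2 * l%:R / 640))
    + 4 * n%:R ^+ 2 / (eps ^+ 2 * l%:R) * expR (- (T%:R / (2 * n%:R)))
  <= delta / N%:R ^+ 2.
Proof.
move=> n1 N2 e0 /andP[d0 d2] l0 hl hT.
have NR : 2 <= N%:R :> R by rewrite ler_nat.
have nR : 0 < n%:R :> R by rewrite ltr0n ltnW.
have nR1 : 1 <= n%:R :> R by rewrite ler1n ltnW.
have lR : 0 < l%:R :> R by rewrite ltr0n.
pose q := delta / N%:R.
have q0 : 0 < q by rewrite divr_gt0//; lra.
have NdE : N%:R / delta = q^-1 by rewrite /q invf_div.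
set L := ln (N%:R / delta) in hl hT.
have expL : expR (- L) = q.
  by rewrite /L NdE lnV ?posrE// opprK lnK ?posrE.
have q4 : q <= 4^-1.
  by rewrite /q ler_pdivrMr; [nra|lra].
(* A crude lower bound, enough for eps^2 l >= 1. *)
have L1 : 4^-1 <= L.
  rewrite -(ler_expR _ L) -[expR L]invrK -expRN expL.
  have h : expR (4^-1) <= 2 :> R.
    have h4 : (4^-1 : R) <= 2^-1 by lra.
    apply: (le_trans (expR_le_quadratic h4)); lra.
  by rewrite (le_trans h)// -div1r ler_pdivlMr//; lra.
have exp4 : expR (4 * - L) = q ^+ 4 by rewrite expRM_natl expL.
have el : 1 <= eps ^+ 2 * l%:R by lra.
have el0 : 0 <= eps ^+ 2 * l%:R by exact: le_trans el.
have b1 : expR (- (eps ^+ 2 * l%:R / 640)) <= q ^+ 4.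
  by rewrite -exp4 ler_expR; lra.
have lnn0 : 0 <= ln n%:R :> R by rewrite ln_ge0.
have b2 : expR (- (T%:R / (2 * n%:R))) <= q ^+ 4 / n%:R ^+ 4.
  have -> : q ^+ 4 / n%:R ^+ 4 = expR (4 * - L + 4 * - ln n%:R).
    by rewrite expRD exp4 expRM_natl expRN lnK ?posrE// exprVn.
  rewrite ler_expR lerNl opprD -!mulrN !opprK -mulrDr ler_pdivlMr ?mulr_gt0//.
  by apply: le_trans hT; rewrite le_eqVlt; apply/orP; left; apply/eqP; ring.
have b3 : 4 * n%:R ^+ 2 / (eps ^+ 2 * l%:R) <= 4 * n%:R ^+ 2.
  by rewrite ler_pdivrMr ?(lt_le_trans _ el)// ler_peMr// mulr_ge0// sqr_ge0.
have b4 : 4 * n%:R ^+ 2 / (eps ^+ 2 * l%:R) * expR (- (T%:R / (2 * n%:R)))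
    <= 4 * q ^+ 4.
  apply: (@le_trans _ _ (4 * n%:R ^+ 2 * (q ^+ 4 / n%:R ^+ 4))).
    apply: ler_pM => //; rewrite ?expR_ge0//.
    by apply: (divr_ge0 _ el0); apply: mulr_ge0 => //; exact: sqr_ge0.
  have -> : 4 * n%:R ^+ 2 * (q ^+ 4 / n%:R ^+ 4) = 4 * q ^+ 4 / n%:R ^+ 2.
    by field; rewrite gt_eqF.
  rewrite ler_pdivrMr ?exprn_gt0// ler_peMr//; last by rewrite exprn_ege1.
  by rewrite mulr_ge0// exprn_ge0// ltW.
have qq : delta / N%:R ^+ 2 = q ^+ 2 / delta.
  by rewrite /q; field; rewrite gt_eqF//=; apply/eqP; lra.
have b5 : 6 * q ^+ 4 <= q ^+ 2 / delta.
  rewrite ler_pdivlMr//.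
  have : q ^+ 4 <= q ^+ 2 * 16^-1.
    rewrite (_ : q ^+ 4 = q ^+ 2 * q ^+ 2); last by ring.
    by apply: ler_wpM2l; [exact: sqr_ge0|nra].
  have : 0 < q ^+ 2 by rewrite exprn_gt0.
  nra.
rewrite qq; lra.
Qed.

Lemma kac_jl (n N : nat) (x : 'M[R]_n) (X : 'I_N -> 'cV[R]_n)
    (eps delta : R) (l T : nat) :
  (1 < n)%N -> special_orthogonal x -> (2 <= N)%N -> injective X ->
  0 < eps < 2^-1 -> 0 < delta < 2^-1 -> (0 < l)%N -> (l <= n)%N ->
  2560 * ln (N%:R / delta) <= eps ^+ 2 * l%:R ->
  8 * n%:R * (ln n%:R + ln (N%:R / delta)) <= T%:R ->
  kac_prob_ge T x (jl_preserves l eps X) (1 - delta).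
Proof.
move=> n1 xSO N2 Xinj /andP[e0 e2] d02 l0 len hl hT d Omega P ij theta drive.
pose walk w := kac_walk ij (fun t => theta t : Omega -> R) x T w.
pose c (q : 'I_N * 'I_N) := l2norm (X q.1 - X q.2).
pose u q : 'cV[R]_n := (c q)^-1 *: (X q.1 - X q.2).
(* The bad events run over all N^2 index pairs, empty unless ordered, so that a budget of delta /
   N^2 each adds up to delta. *)
pose F (q : 'I_N * 'I_N) := if (q.1 < q.2)%N then
  [set w | deviation (n := n) eps l (energy (first_weights l) (walk w *m u q))]
  else set0.
(* Distinct points allow each difference to be normalized to a unit vector. *)
have c0 (q : 'I_N * 'I_N) : (q.1 < q.2)%N -> 0 < c q.
  move=> q12; rewrite sqrtr_gt0 lt_def sumr_ge0 ?andbT; last by move=> *; exact: sqr_ge0.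
  apply/negP => /eqP/psumr_eq0P s0.
  have : X q.1 = X q.2.
    apply/eqP; rewrite -subr_eq0; apply/eqP/matrixP => i j; rewrite (ord1 j) !mxE.
    have /eqP := s0 (fun k _ => sqr_ge0 _) i isT.
    by rewrite sqrf_eq0 !mxE => /eqP.
  by move/Xinj => q1q2; rewrite q1q2 ltnn in q12.
have u1 (q : 'I_N * 'I_N) : (q.1 < q.2)%N -> \sum_k u q k ord0 ^+ 2 = 1.
  move=> /c0 cq; rewrite -l2normK /u /l2norm.
  rewrite (eq_bigr (fun k => (c q) ^- 2 * (X q.1 - X q.2) k ord0 ^+ 2)); last first.
    by move=> k _; rewrite mxE exprMn exprVn.
  by rewrite -mulr_sumr -l2normK -/(c q) mulVf ?sqrtr1 ?expr1n// gt_eqF// exprn_gt0.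
have FP q : measurable (F q) /\ (P (F q) <= (delta / N%:R ^+ 2)%:E)%E.
  rewrite /F; case: ifP => q12; last first.
    split; first exact: measurable0.
    by rewrite measure0 lee_fin divr_ge0 ?sqr_ge0//; case/andP: d02 => /ltW.
  have xu : \sum_k (x *m u q) k ord0 ^+ 2 = 1 by rewrite sum_sqr_orthogonal// u1.
  have [mF PF] := kac_deviation e0 e2 l0 n1 T drive len xu.
  split => //; apply: (le_trans PF); rewrite lee_fin.
  exact: pair_bound.
pose Bad := \big[setU/set0]_(q : 'I_N * 'I_N) F q.
have mBad : measurable Bad by apply: bigsetU_measurable => q _; exact: (FP q).1.
have -> : [set w | jl_preserves l eps X (walk w)] = ~` Bad.
  rewrite /Bad -bigcup_seq setC_bigcup.
  have uE (q : 'I_N * 'I_N) : (q.1 < q.2)%N -> c q *: u q = X q.1 - X q.2.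
    by move=> q12; rewrite scalerA divff ?scale1r// gt_eqF// c0.
  apply/seteqP; split => w /=.
    move=> jl q _; rewrite /F; case: ifP => q12; last by [].
    rewrite /=; apply/(jl_deviation eps (walk w) l0 len (c0 _ q12) (u1 _ q12)).
    by rewrite uE//; exact: jl.
  move=> good i j ij12; have /= := good (i, j) (mem_index_enum _).
  rewrite /F/= ij12 => /(jl_deviation eps (walk w) l0 len (c0 (i, j) ij12) (u1 (i, j) ij12)).
  by rewrite uE.
rewrite probability_setC//.
have PBad : (P Bad <= delta%:E)%E.
  apply: (le_trans (measure_bigsetU_le _ _ (fun q => (FP q).1))).
  apply: (@le_trans _ _ (\sum_(q : 'I_N * 'I_N) (delta / N%:R ^+ 2)%:E)%E).
    by apply: lee_sum => q _; exact: (FP q).2.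
  rewrite sumEFin lee_fin sumr_const card_prod card_ord mulnn.
  rewrite -[leLHS]mulr_natr natrX divfK// expf_neq0// pnatr_eq0 -lt0n.
  exact: ltnW.
rewrite EFinB leeB//.
Qed.

End johnson_lindenstrauss.

(** * Numerical bounds on the parameters, and the theorem *)

Section parameters.
Context {R : realType}.

(** The quadratic bound at 1/2 gives exp (1/2) <= 2, hence e <= 4. *)
Lemma ln_ge1 (y : R) : 4 <= y -> 1 <= ln y.
Proof.
move=> y4; have y0 : 0 < y by lra.
rewrite -ler_expR lnK ?posrE//; apply: le_trans y4.
have h : expR (2^-1) <= 2 :> R by apply: (le_trans (expR_le_quadratic (lexx _))); lra.
have -> : expR 1 = expR (2^-1) ^+ 2 :> R by rewrite -expRM_natl divff.
rewrite [leRHS](_ : _ = 2 ^+ 2); last by ring.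
by apply: lerXn2r; rewrite ?nnegrE// expR_ge0.
Qed.

Lemma ln_card_ratio_ge1 (N : nat) (delta : R) :
  (2 <= N)%N -> 0 < delta < 2^-1 -> 1 <= ln (N%:R / delta).
Proof.
move=> N2 /andP[d0 d2]; have NR : 2 <= N%:R :> R by rewrite ler_nat.
by apply: ln_ge1; rewrite ler_pdivlMr//; lra.
Qed.

Lemma jl_r_bounds (N : nat) (delta : R) :
  ln (N%:R / delta) <= (jl_r N delta)%:~R < ln (N%:R / delta) + 1.
Proof.
have /andP[h ->] := ceil_itv (ln (N%:R / delta)).
by move: h; rewrite intrB /jl_r /= ltrBlDr.
Qed.

Lemma jl_dimension_le (N l : nat) (eps delta : R) :
  (2 <= N)%N -> 0 < eps -> 0 < delta < 2^-1 ->
  2560 * eps ^- 2 * (jl_r N delta)%:~R <= l%:R ->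
  (0 < l)%N /\ 2560 * ln (N%:R / delta) <= eps ^+ 2 * l%:R.
Proof.
move=> N2 e0 d02 hl; have L1 := ln_card_ratio_ge1 N2 d02.
have /andP[r1 _] := jl_r_bounds N delta.
move: L1 r1 hl; set L := ln _; set r := _%:~R => L1 r1 hl.
have e20 : 0 < eps ^+ 2 by rewrite exprn_gt0.
have h : 2560 * r <= eps ^+ 2 * l%:R.
  apply: le_trans (ler_wpM2l (ltW e20) hl).
  by rewrite le_eqVlt; apply/orP; left; apply/eqP; field; rewrite gt_eqF.
have h2 : 2560 * L <= eps ^+ 2 * l%:R by lra.
split=> //; rewrite -(ltr0n R) -(pmulr_rgt0 _ e20); lra.
Qed.

End parameters.

Theorem theorem6p1 (R : realType) :
  exists C_JL : R, 0 < C_JL /\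
    (forall (n : nat) (x : 'M[R]_n) (N : nat) (X : 'I_N -> 'cV[R]_n)
        (eps delta : R) (l T : nat),
      (2 <= n)%N ->
      special_orthogonal x ->
      (2 <= N)%N ->
      injective X ->
      0 < eps < 2^-1 ->
      0 < delta < 2^-1 ->
      let r := jl_r N delta in
      4 * r < n%:Z ->
      C_JL * eps ^- 2 * r%:~R <= l%:R ->
      (l < n)%N ->
      C_JL * n%:R * (4 * r%:~R + ln n%:R)
        * (r%:~R * ln (n%:R / eps) + ln (N%:R / delta)) <= T%:R ->
      kac_prob_ge T x (jl_preserves l eps X) (1 - delta)) /\
    (exists C_dim : R, 0 < C_dim /\
      forall A : R, exists C_dimA : R, 0 < C_dimA /\
      forall eps : R, 0 < eps < 2^-1 -> exists C_A : R, 0 < C_A /\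
      forall (n : nat) (x : 'M[R]_n) (N : nat) (X : 'I_N -> 'cV[R]_n)
        (delta : R),
      (2 <= n)%N ->
      special_orthogonal x ->
      (2 <= N)%N ->
      injective X ->
      0 < delta < 2^-1 ->
      N%:R / delta <= n%:R `^ A ->
      let r := jl_r N delta in
      4 * r < n%:Z ->
      (exists l0 : nat,
        [/\ C_JL * eps ^- 2 * r%:~R <= l0%:R,
            l0%:R <= C_dim * eps ^- 2 * ln (N%:R / delta)
          & l0%:R <= C_dimA * eps ^- 2 * ln n%:R]) /\
      (forall l T : nat,
        C_JL * eps ^- 2 * r%:~R <= l%:R ->
        (l < n)%N ->
        C_A * n%:R * ln n%:R ^+ 3 <= T%:R ->
        kac_prob_ge T x (jl_preserves l eps X) (1 - delta))).
Proof.
(* The dimension constant of [kac_jl]; it also exceeds the factor 8 required of the time. *)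
exists 2560; split; first by rewrite ltr0n.
split.
  move=> n x N X eps delta l T n2 xSO N2 Xinj e02 d02 r rn hl len hT.
  have /andP[e0 e2] := e02.
  have [l0 hl'] := jl_dimension_le N2 e0 d02 hl.
  apply: kac_jl => //; first exact: ltnW.
  apply: le_trans hT.
  have L1 := ln_card_ratio_ge1 N2 d02.
  have /andP[r1 _] := jl_r_bounds N delta.
  rewrite -/r in r1; move: (r%:~R) L1 r1 => s; set L := ln (_ / delta) => L1 s1.
  have nR : 2 <= n%:R :> R by rewrite ler_nat.
  have nR0 : 0 < n%:R :> R by lra.
  have lnn0 : 0 <= ln n%:R :> R by rewrite ln_ge0// ler1n ltnW.
  have lne : ln n%:R <= ln (n%:R / eps).
    rewrite ler_ln ?posrE ?divr_gt0// ler_pdivlMr//.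
    by apply: ler_piMr; [exact: ltW|lra].
  (* The assumed time is much longer than required: its first factor is at least 1 and its second is
     at least ln n + L. *)
  have a1 : 1 <= 4 * s + ln n%:R by lra.
  have a2 : ln n%:R + L <= s * ln (n%:R / eps) + L.
    rewrite lerD2r; apply: (le_trans lne).
    by apply: ler_peMl; [exact: le_trans lne|exact: le_trans s1].
  have a0 : 0 <= ln n%:R + L by lra.
  have a3 : ln n%:R + L <= (4 * s + ln n%:R) * (s * ln (n%:R / eps) + L).
    apply: (le_trans a2); apply: ler_peMl => //; exact: le_trans a2.
  have -> : 2560 * n%:R * (4 * s + ln n%:R) * (s * ln (n%:R / eps) + L)
    = 2560 * n%:R * ((4 * s + ln n%:R) * (s * ln (n%:R / eps) + L)) by ring.
  apply: ler_pM => //.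
  lra.
(* 5121 = 2 * 2560 + 1: the bound r <= L + 1 <= 2 L costs the factor 2, and rounding up costs at
   most 1 <= eps^-2 L. *)
exists 5121; split; first by rewrite ltr0n.
move=> A; have A0 : 0 <= `|A| by exact: normr_ge0.
(* Here L <= |A| ln n is inserted; the summand 1 keeps the constant positive. *)
exists (5121 * `|A| + 1); split; first by lra.
move=> eps e02; have /andP[e0 e2] := e02.
(* From ln n + L <= (1 + |A|) ln n; the cube of ln n is larger still, as ln n >= 1. *)
exists (8 * (1 + `|A|)); split; first by lra.
move=> n x N X delta n2 xSO N2 Xinj d02 NA r rn.
have L1 := ln_card_ratio_ge1 N2 d02.
have := jl_r_bounds N delta; rewrite -/r => /andP[r1 r2].
(* Since r >= L >= 1, the requirement 4 r < n forces n > 4, and so ln n >= 1. *)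
have nR : 4 <= n%:R :> R.
  have : 4 * r%:~R < n%:R :> R by rewrite -(ltr_int R) intrM in rn.
  lra.
have nR0 : 0 < n%:R :> R by lra.
have lnn1 : 1 <= ln n%:R :> R by exact: ln_ge1.
have Lpos : 0 < N%:R / delta.
  by apply: divr_gt0; [rewrite ltr0n ltnW|case/andP: d02].
have LA : ln (N%:R / delta) <= `|A| * ln n%:R.
  apply: (@le_trans _ _ (A * ln n%:R)).
    by rewrite -ln_powR ler_ln ?posrE// powR_gt0.
  by apply: ler_wpM2r; [lra|exact: ler_norm].
split.
  move: L1 r1 r2 LA; set L := ln (_ / delta); set s := r%:~R => L1 r1 r2 LA.
  pose y := 2560 * eps ^- 2 * s.
  have E0 : 1 <= eps ^- 2.
    rewrite -exprVn; apply: exprn_ege1; rewrite -div1r ler_pdivlMr//; lra.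
  have y0 : 0 <= y by apply: mulr_ge0; [apply: mulr_ge0|]; lra.
  have yl : y <= `|Num.ceil y|%N%:R.
    rewrite natr_absz ger0_norm ?ceil_ge//.
    by rewrite ceil_ge0; lra.
  have ly : `|Num.ceil y|%N%:R <= 5121 * eps ^- 2 * L.
    rewrite natr_absz ger0_norm; last by rewrite ceil_ge0; lra.
    have /andP[h _] := ceil_itv y.
    have h2 : (Num.ceil y)%:~R <= y + 1 by rewrite intrB in h; lra.
    apply: (le_trans h2); rewrite /y.
    have : eps ^- 2 * s <= eps ^- 2 * (2 * L) by apply: ler_wpM2l; lra.
    have : 1 * 1 <= eps ^- 2 * L by apply: ler_pM.
    lra.
  exists `|Num.ceil y|%N; split => //; apply: (le_trans ly).
  have : eps ^- 2 * L <= eps ^- 2 * (`|A| * ln n%:R) by apply: ler_wpM2l => //; lra.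
  have : 0 <= eps ^- 2 * ln n%:R by apply: mulr_ge0; lra.
  lra.
move=> l T hl len hT.
have [l0 hl'] := jl_dimension_le N2 e0 d02 hl.
apply: kac_jl => //; first exact: ltnW.
apply: le_trans hT.
have -> : 8 * (1 + `|A|) * n%:R * ln n%:R ^+ 3
  = 8 * n%:R * ((1 + `|A|) * ln n%:R ^+ 3) by ring.
apply: ler_wpM2l; first by apply: mulr_ge0 => //; exact: ltW.
apply: (@le_trans _ _ ((1 + `|A|) * ln n%:R)); first by lra.
apply: ler_wpM2l; first by lra.
by apply: ler_eXnr.
Qed.
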